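(* Let $\Delta$ be a lattice polygon and let $\tilde\rho$ be the tentacle-position map with values in $\mathbb R^n/\mathbb R^2\cong\mathbb R^{n-2}$. The restriction $\tilde\rho|_{\mathcal H_{0,\Delta}}$ of $\tilde\rho$ to the moduli space $\mathcal H_{0,\Delta}$ of rational Harnack curves with Newton polygon $\Delta$ is a smooth embedding.
   Context: $\Delta\subset\mathbb R^2$ is a two-dimensional convex lattice polygon with edges $\Gamma_1,\dots,\Gamma_m$ in cyclic anticlockwise order, $d_i$ the integer length of $\Gamma_i$, $u_i=(u_{i1},u_{i2})\in\mathbb Z^2$ the primitive inner normal vector of $\Gamma_i$, and $n=\sum_i d_i$ the number of boundary lattice points; $g$ is the number of interior lattice points. $X_\Delta$ is the projective toric surface, $L_i$ the torus-invariant divisor (axis) of $\Gamma_i$. For a real Laurent polynomial $f$ with Newton polygon $\Delta$, $C^\circ\subset(\mathbb C^* )^2$ is its zero set, $C$ the closure in $X_\Delta$, $\mathbb RC=C\cap\mathbb RX_\Delta$. $\mathbb RC$ is a smooth Harnack curve if it is smooth, has $g+1$ connected components, only one component meets $L_1\cup\dots\cup L_m$, and that component can be subdivided into $m$ disjoint arcs $\theta_1,\dots,\theta_m$, in that order, with $C\cap L_i=\theta_i\cap L_i$. $\mathbb RC$ is a Harnack curve if its only singularities are ordinary isolated double points away from the axes and replacing each by a small oval around it gives a curve having, together with $\mathbb RX_\Delta$ and the real axes, the (unique) topological type of smooth Harnack curves. $\mathcal H_\Delta$ is the space of Harnack curves with Newton polygon $\Delta$, as a subspace of $\mathbb P(\mathbb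 R[\Delta\cap\mathbb Z^2])$ modulo the action $f(x_1,x_2)\mapsto f(r_1^{-1}x_1,r_2^{-1}x_2)$ of $(\mathbb R^* )^2$; $\mathcal H_{0,\Delta}\subset\mathcal H_\Delta$ is the subspace of rational Harnack curves. Rational Harnack curves with Newton polygon $\Delta$ are exactly the curves for which $C^\circ$ is parametrized, in some chart of $\mathbb{CP}^1$, by $t\mapsto\left(\prod_{i=1}^m b_i^{u_{i1}}\prod_{j=1}^{d_i}(t-a_{i,j})^{u_{i1}},\ \prod_{i=1}^m b_i^{u_{i2}}\prod_{j=1}^{d_i}(t-a_{i,j})^{u_{i2}}\right)$ with $b_i\in\mathbb R^*$ and real roots satisfying $a_{1,1}\le\dots\le a_{1,d_1}<a_{2,1}\le\dots\le a_{2,d_2}<\dots<a_{m,1}\le\dots\le a_{m,d_m}$. The class in $\mathcal H_\Delta$ does not depend on the $b_i$, and determines the roots up to the action of $\mathrm{PSL}_2(\mathbb R)$ by Möbius transformations applied to all roots; in this way $\mathcal H_{0,\Delta}$ is identified with the space of such root tuples modulo $\mathrm{PSL}_2(\mathbb R)$, a manifold with corners of dimension $n-3$. For $u,w\in\mathbb R^2$ let $u\wedge w$ be the determinant of the matrix with columns $u,w$ in that order, and $J=\left(\begin{smallmatrix}0&1\\-1&0\end{smallmatrix}\right)$. Define $\rho=(\rho_{i,j})_{1\le i\le m,\,1\le j\le d_i}$ on root tuples by $$\rho_{i,j}(a)=\sum_{k\ne i}\ \sum_{l=1}^{d_k}(u_k\wedge u_i)\log|a_{i,j}-a_{k,l}|,$$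 the outer sum over $k\in\{1,\dots,m\}\setminus\{i\}$. Let $r\in\mathbb R^2$ act on $\mathbb R^n$ by $(r\cdot\rho)_{i,j}=\rho_{i,j}+\langle Ju_i,r\rangle$ (translation of the amoeba). Acting on the roots by $\mathrm{PSL}_2(\mathbb R)$ changes $\rho$ only by this $\mathbb R^2$-action, so $\rho$ descends to a map $\tilde\rho$ from root tuples modulo $\mathrm{PSL}_2(\mathbb R)$ to $\mathbb R^n/\mathbb R^2\cong\mathbb R^{n-2}$, hence a map on $\mathcal H_{0,\Delta}$. *)

(* Defs.v *)
From HB Require Import structures.
From mathcomp Require Import all_boot all_order all_algebra.
From mathcomp Require Import all_classical all_reals all_analysis.
From mathcomp Require Import ring.

Set Implicit Arguments.
Unset Strict Implicit.
Unset Printing Implicit Defensive.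

Import Order.TTheory GRing.Theory Num.Theory.
Import numFieldNormedType.Exports.

Local Open Scope classical_set_scope.
Local Open Scope quotient_scope.
Local Open Scope ring_scope.

Section SmoothMaps.
Variables (R : realType) (V W : normedModType R).

Fixpoint Ck_on (r : nat) (U : set V) (f : V -> W) : Prop :=
  match r with
  | 0 => forall x, U x -> {for x, continuous f}
  | r'.+1 => (forall x, U x -> differentiable f x) /\
             (forall v, Ck_on r' U (fun x => 'D_v f x))
  end.

Definition smooth_on (U : set V) (f : V -> W) : Prop :=
  open U /\ forall r, Ck_on r U f.

(* On D, f is a smooth function of the coordinate c : T -> V: near each point
   it is the composite with c of a smooth map on an open subset of V.  With
   c the inclusion of a subset of V this is the usual smoothness on an
   arbitrary subset, as used for manifolds with corners. *)
Definition smooth_along (T : Type) (D : set T) (c : T -> V) (f : T -> W) :=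
  forall x, D x -> exists U g,
    [/\ smooth_on U g, U (c x) & forall y, D y -> U (c y) -> g (c y) = f y].

End SmoothMaps.

Section QuotientManifolds.
Variable R : realType.

Definition corner_sector (k p : nat) : set 'rV[R]_k :=
  [set y | forall i : 'I_k, (i < p)%N -> 0 <= y ord0 i].

(* X is a quotient, with projection proj and the quotient topology, of a subspace
   T of R^n with inclusion iota.  The smooth structure of X is the one making proj
   a submersion: its charts phi are the coordinates, with values in a relatively
   open subset of [0,+oo[^p x R^(k-p), that are smooth on T and admit a smooth
   section of proj.  These clauses together make phi a homeomorphism onto its
   image and any two charts compatible. *)
Definition smooth_chart (T : Type) (n : nat) (iota : T -> 'rV[R]_n)
    (X : topologicalType) (proj : T -> X) (k : nat)
    (D : set X) (phi : X -> 'rV[R]_k) : Prop :=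
  [/\ open D,
      exists p O, open O /\ phi @` D = O `&` corner_sector p,
      smooth_along [set a : T | D (proj a)] iota (fun a => phi (proj a))
    & exists s : X -> T,
        (forall x, D x -> proj (s x) = x) /\
        smooth_along D phi (fun x => iota (s x))].

(* f is represented in charts of dimensions k and l around x and f x by a
   smooth map g with injective differential.  At a corner, g is a smooth
   extension to a full neighbourhood; its differential there does not depend
   on the extension. *)
Definition immersive_at (T1 T2 : Type) (n1 n2 : nat)
    (iota1 : T1 -> 'rV[R]_n1) (iota2 : T2 -> 'rV[R]_n2)
    (X1 X2 : topologicalType) (proj1 : T1 -> X1) (proj2 : T2 -> X2)
    (k l : nat) (f : X1 -> X2) (x : X1) : Prop :=
  exists D (phi : X1 -> 'rV[R]_k) E (psi : X2 -> 'rV[R]_l),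
    [/\ smooth_chart iota1 proj1 D phi, D x, smooth_chart iota2 proj2 E psi, E (f x)
      & exists U (g : 'rV[R]_k -> 'rV[R]_l),
          [/\ smooth_on U g, U (phi x),
              forall y, D y -> E (f y) -> U (phi y) -> g (phi y) = psi (f y)
            & injective ('d g (phi x))]].

Definition topological_embedding (X Y : topologicalType) (f : X -> Y) : Prop :=
  injective f /\
  forall U : set X, open U <-> exists O : set Y, open O /\ U = f @^-1` O.

Definition smooth_embedding (T1 T2 : Type) (n1 n2 : nat)
    (iota1 : T1 -> 'rV[R]_n1) (iota2 : T2 -> 'rV[R]_n2)
    (X1 X2 : topologicalType) (proj1 : T1 -> X1) (proj2 : T2 -> X2)
    (k l : nat) (f : X1 -> X2) : Prop :=
  topological_embedding f /\ forall x, immersive_at iota1 iota2 proj1 proj2 k l f x.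

End QuotientManifolds.

Definition wedge (A : pzRingType) (u w : A * A) : A := u.1 * w.2 - u.2 * w.1.

(* The vertices, listed anticlockwise: all other vertices lie strictly to the
   left of the line from each vertex to the next one. *)
Record lattice_polygon := LatticePolygon {
  nb_edges : nat;
  vertex : 'I_nb_edges -> int * int;
  nb_edges_ge3 : (3 <= nb_edges)%N;
  vertex_convex : forall i k, k != i -> k != ordS i ->
        0 < wedge (vertex (ordS i) - vertex i) (vertex k - vertex i)
}.

Section Polygon.
Variable P : lattice_polygon.
Implicit Types i k : 'I_(nb_edges P).

Definition edge i : int * int := vertex (ordS i) - vertex i.

Definition edge_length i : nat := gcdn `|(edge i).1|%N `|(edge i).2|%N.

(* The edge is divided by its integer length and turned by +90 degrees. *)
Definition inner_normal i : int * int :=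
  (- ((edge i).2 %/ (edge_length i)%:Z)%Z, ((edge i).1 %/ (edge_length i)%:Z)%Z).

Definition root_index : finType := {i : 'I_(nb_edges P) & 'I_(edge_length i)}.

Definition nb_boundary_points : nat := #|root_index|.

Lemma nb_boundary_pointsE : nb_boundary_points = (\sum_i edge_length i)%N.
Proof.
rewrite /nb_boundary_points card_tagged sumnE big_map big_enum /=.
by apply: eq_bigr => i _; rewrite card_ord.
Qed.

Lemma inner_normal_sum :
  (\sum_i (inner_normal i).1 *+ edge_length i = 0) /\
  (\sum_i (inner_normal i).2 *+ edge_length i = 0).
Proof.
have E : \sum_i edge i = 0.
  rewrite /edge sumrB [X in X - _ = 0](_ : _ = \sum_i @vertex P i) ?subrr//.
  by rewrite [RHS](reindex_inj (bij_inj (@ordS_bij _))).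
have dvd1 i : ((edge_length i)%:Z %| (edge i).1)%Z.
  by rewrite dvdzE /=; exact: dvdn_gcdl.
have dvd2 i : ((edge_length i)%:Z %| (edge i).2)%Z.
  by rewrite dvdzE /=; exact: dvdn_gcdr.
split.
- transitivity (\sum_i - (edge i).2).
    apply: eq_bigr => i _.
    by rewrite /inner_normal /= mulNrn -[_ *+ _]mulr_natr natz divzK // dvd2.
  by rewrite sumrN -(raddf_sum snd) E oppr0.
- transitivity (\sum_i (edge i).1).
    apply: eq_bigr => i _.
    by rewrite /inner_normal /= -[_ *+ _]mulr_natr natz divzK // dvd1.
  by rewrite -(raddf_sum fst) E.
Qed.

End Polygon.

Section Moduli.
Variables (R : realType) (P : lattice_polygon).
Notation n := (nb_boundary_points P).
Notation "'Rn'" := 'rV[R]_n.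
Implicit Types (a b w : Rn) (i k : 'I_(nb_edges P)).

Definition normal i : R * R :=
  ((inner_normal i).1%:~R, (inner_normal i).2%:~R).

Definition entry a i (j : 'I_(edge_length i)) : R :=
  a ord0 (enum_rank (Tagged (fun i => 'I_(edge_length i)) j : root_index P)).
Arguments entry : clear implicits.

(* R^n is indexed by the pairs (i, j) through enum_rank. *)
Definition of_entries (f : forall i, 'I_(edge_length i) -> R) : Rn :=
  \row_x f (tag (enum_val x)) (tagged (enum_val x)).

Lemma of_entriesK f i j : entry (of_entries f) i j = f i j.
Proof. by rewrite /entry mxE enum_rankK. Qed.

Definition harnack_roots : set Rn :=
  [set a | (forall i (j l : 'I_(edge_length i)), (j <= l)%N ->
              entry a i j <= entry a i l) /\
           (forall i k (j : 'I_(edge_length i)) (l : 'I_(edge_length k)),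
              (i < k)%N -> entry a i j < entry a k l)].

Definition moebius_related a b : Prop :=
  exists p q r s : R, p * s - q * r = 1 /\
    forall x, r * a ord0 x + s != 0 /\
              b ord0 x = (p * a ord0 x + q) / (r * a ord0 x + s).

Definition moebius_eq (a b : set_type harnack_roots) : bool :=
  `[< moebius_related (val a) (val b) >].

Lemma moebius_eq_refl : reflexive moebius_eq.
Proof.
move=> a; apply/asboolP; exists 1, 0, 0, 1; split; first by ring.
by move=> x; rewrite !mul0r !add0r mul1r addr0 divr1 oner_neq0.
Qed.

Lemma moebius_related_sym a b : moebius_related a b -> moebius_related b a.
Proof.
move=> [p [q [r [s [det H]]]]]; exists s, (- q), (- r), p.
split=> [|x]; first by rewrite -det; ring.
have [den ->] := H x.
have -> : - r * ((p * a ord0 x + q) / (r * a ord0 x + s)) + p =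
          (r * a ord0 x + s)^-1.
  apply: (mulIf den); rewrite mulVf // mulrDl mulrA mulfVK //.
  by rewrite -[RHS]det; ring.
split; first by rewrite invr_eq0.
rewrite invrK mulrDl mulrA mulfVK //.
by rewrite -[LHS]mul1r -det; ring.
Qed.

Lemma moebius_related_trans b a c :
  moebius_related a b -> moebius_related b c -> moebius_related a c.
Proof.
move=> [p [q [r [s [det H]]]]] [p' [q' [r' [s' [det' H']]]]].
exists (p' * p + q' * r), (p' * q + q' * s), (r' * p + s' * r), (r' * q + s' * s).
split=> [|x].
  transitivity ((p' * s' - q' * r') * (p * s - q * r)); first by ring.
  by rewrite det det' mulr1.
have [den bE] := H x; have [den' ->] := H' x; rewrite bE in den' *.
set A := a ord0 x in den den' *.
have E : (r' * p + s' * r) * A + (r' * q + s' * s) =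
         (r' * ((p * A + q) / (r * A + s)) + s') * (r * A + s).
  by field.
split; first by rewrite E mulf_neq0.
rewrite E; field.
rewrite den /= (_ : _ + _ = (r' * p + s' * r) * A + (r' * q + s' * s)); first by rewrite E mulf_neq0.
by ring.
Qed.

Lemma moebius_eq_sym : symmetric moebius_eq.
Proof.
by move=> a b; apply/asboolP/asboolP; exact: moebius_related_sym.
Qed.

Lemma moebius_eq_trans : transitive moebius_eq.
Proof.
by move=> b a c /asboolP ab /asboolP bc; apply/asboolP;
  exact: moebius_related_trans ab bc.
Qed.

Canonical moebius_equiv :=
  EquivRel moebius_eq moebius_eq_refl moebius_eq_sym moebius_eq_trans.

(* The moduli space H_{0,Delta}: a rational Harnack curve, up to the torus
   action, is determined by the roots a of its parametrization
     t |-> (prod_i b_i^{u_i1} prod_j (t - a_{i,j})^{u_i1},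
            prod_i b_i^{u_i2} prod_j (t - a_{i,j})^{u_i2})
   (the b_i are immaterial), and determines them up to PSL_2(R).  The roots are
   taken in affine charts of P^1(R): a Moebius transformation relates two root
   tuples when it has no pole at the roots and preserves the order condition.
   This quotient is the one of cyclically ordered tuples in P^1(R), since every
   orbit meets the open set of tuples satisfying harnack_roots. *)
Definition rational_harnack := quotient_topology {eq_quot moebius_equiv}.
HB.instance Definition _ := Topological.on rational_harnack.

Definition rho a : Rn :=
  of_entries (fun i j =>
    \sum_(k | k != i) \sum_(l < edge_length k)
      wedge (normal k) (normal i) * ln `|entry a i j - entry a k l|).

(* The pairing <J u_i, r>, with J u = (u_2, - u_1). *)
Definition shift (r : R * R) i : R := (normal i).2 * r.1 - (normal i).1 * r.2.

Definition translate (r : R * R) w : Rn :=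
  of_entries (fun i j => entry w i j + shift r i).

Lemma entryP a b : (forall i j, entry a i j = entry b i j) -> a = b.
Proof.
move=> H; apply/rowP => x; have := H (tag (enum_val x)) (tagged (enum_val x)).
by rewrite /entry -![Tagged _ _]/(existT _ _ _) /= -sigT_eta enum_valK.
Qed.

Definition translation_eq (w w' : Rn) : bool :=
  `[< exists r, w' = translate r w >].

Lemma translation_eq_refl : reflexive translation_eq.
Proof.
move=> w; apply/asboolP; exists 0; apply: entryP => i j.
by rewrite of_entriesK /shift !mulr0 subr0 addr0.
Qed.

Lemma translation_eq_sym : symmetric translation_eq.
Proof.
have H w w' : (exists r, w' = translate r w) -> exists r, w = translate r w'.
  move=> [r ->]; exists (- r); apply: entryP => i j.
  by rewrite !of_entriesK /shift /=; ring.
by move=> w w'; apply/asboolP/asboolP; exact: H.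
Qed.

Lemma translation_eq_trans : transitive translation_eq.
Proof.
move=> w' w w'' /asboolP[r ->] /asboolP[r' ->]; apply/asboolP.
exists (r + r'); apply: entryP => i j.
by rewrite !of_entriesK /shift /=; ring.
Qed.

Canonical translation_equiv :=
  EquivRel translation_eq translation_eq_refl translation_eq_sym
    translation_eq_trans.

(* R^n / R^2 *)
Definition tentacle_positions := quotient_topology {eq_quot translation_equiv}.
HB.instance Definition _ := Topological.on tentacle_positions.

Definition rational_harnack_proj (a : set_type harnack_roots) : rational_harnack :=
  \pi_rational_harnack a.

Definition tentacle_positions_proj (w : Rn) : tentacle_positions :=
  \pi_tentacle_positions w.

Definition rho_tilde (x : rational_harnack) : tentacle_positions :=
  tentacle_positions_proj (rho (val (repr x))).

Lemma normal_sum :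
  (\sum_i \sum_(j < edge_length i) (normal i).1 = 0) /\
  (\sum_i \sum_(j < edge_length i) (normal i).2 = 0).
Proof.
have [S1 S2] := inner_normal_sum P.
split.
- rewrite -[RHS](rmorph0 (intmul 1)) -S1 rmorph_sum.
  by apply: eq_bigr => i _; rewrite sumr_const card_ord rmorphMn.
- rewrite -[RHS](rmorph0 (intmul 1)) -S2 rmorph_sum.
  by apply: eq_bigr => i _; rewrite sumr_const card_ord rmorphMn.
Qed.

(* The choice of representative in rho_tilde is immaterial. *)
Lemma rho_moebius (a b : set_type harnack_roots) :
  moebius_related (val a) (val b) -> exists r, rho (val b) = translate r (rho (val a)).
Proof.
move=> [p [q [r [s [det H]]]]].
pose c k (l : 'I_(edge_length k)) := ln `|r * entry (val a) k l + s|.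
pose S1 := \sum_k (normal k).1 * \sum_(l < edge_length k) c k l.
pose S2 := \sum_k (normal k).2 * \sum_(l < edge_length k) c k l.
exists (- S1, - S2); apply: entryP => i j; rewrite !of_entriesK.
have fullsum (F : forall k, 'I_(edge_length k) -> R) :
  \sum_(k | k != i) \sum_(l < edge_length k) wedge (normal k) (normal i) * F k l =
  \sum_k \sum_(l < edge_length k) wedge (normal k) (normal i) * F k l.
  rewrite [RHS](bigD1 i) //= [X in _ = X + _]big1 ?add0r // => l _.
  by rewrite /wedge [X in X - _]mulrC subrr mul0r.
have nea k l : k != i -> 0 < `|entry (val a) i j - entry (val a) k l|.
  move=> ki; rewrite normr_gt0 subr_eq0.
  have /set_mem[_ lt] := valP a.
  move: ki; rewrite neq_ltn => /orP[ki|ik].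
    by rewrite gt_eqF // lt.
  by rewrite lt_eqF // lt.
have E k l : k != i ->
    wedge (normal k) (normal i) * ln `|entry (val b) i j - entry (val b) k l| =
    wedge (normal k) (normal i) * ln `|entry (val a) i j - entry (val a) k l|
    + (- wedge (normal k) (normal i) * c i j
       - wedge (normal k) (normal i) * c k l).
  move=> ki.
  have [d1 e1] : r * entry (val a) i j + s != 0 /\
     entry (val b) i j = (p * entry (val a) i j + q) / (r * entry (val a) i j + s)
    by exact: H.
  have [d2 e2] : r * entry (val a) k l + s != 0 /\
     entry (val b) k l = (p * entry (val a) k l + q) / (r * entry (val a) k l + s)
    by exact: H.
  have -> : entry (val b) i j - entry (val b) k l =
      (entry (val a) i j - entry (val a) k l) /
      ((r * entry (val a) i j + s) * (r * entry (val a) k l + s)).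
    transitivity ((p * s - q * r) * (entry (val a) i j - entry (val a) k l) /
      ((r * entry (val a) i j + s) * (r * entry (val a) k l + s))).
      by rewrite e1 e2; field; rewrite d1 d2.
    by rewrite det mul1r.
  rewrite normrM normfV normrM ln_div ?posrE ?mulr_gt0 ?normr_gt0 //; last first.
    by rewrite -normr_gt0; exact: nea.
  by rewrite lnM ?posrE ?normr_gt0 // /c; ring.
rewrite (eq_bigr (fun k => \sum_(l < edge_length k)
    (wedge (normal k) (normal i) * ln `|entry (val a) i j - entry (val a) k l|
    + (- wedge (normal k) (normal i) * c i j
       - wedge (normal k) (normal i) * c k l)))); last first.
  by move=> k ki; apply: eq_bigr => l _; exact: E.
under eq_bigr do rewrite big_split /=.
rewrite big_split /=; congr (_ + _).
transitivity (\sum_k \sum_(l < edge_length k)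
   ((- (normal i).2 * c i j) * (normal k).1 + ((normal i).1 * c i j) * (normal k).2
    + (- (normal i).2 * ((normal k).1 * c k l)
       + (normal i).1 * ((normal k).2 * c k l)))).
  under eq_bigr => k ki.
    under eq_bigr => l _.
      rewrite (_ : _ - _ = wedge (normal k) (normal i) * (- c i j - c k l)); last by ring.
      over.
    over.
  rewrite fullsum; apply: eq_bigr => k _; apply: eq_bigr => l _.
  by rewrite /wedge; ring.
under eq_bigr do rewrite !big_split /= -!mulr_sumr.
have [N1 N2] := normal_sum.
rewrite !big_split /= -!mulr_sumr N1 N2 /S1 /S2 /shift /=; ring.
Qed.

Lemma rho_tilde_pi (a : set_type harnack_roots) :
  rho_tilde (rational_harnack_proj a) = tentacle_positions_proj (rho (val a)).
Proof.
apply/eqmodP/asboolP; apply: rho_moebius.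
by have /eqmodP/asboolP := reprK (\pi_rational_harnack a).
Qed.

End Moduli.

(* Main.v *)
Require Import Defs.
From mathcomp Require Import all_boot all_order all_algebra.
From mathcomp Require Import all_classical all_reals all_analysis.
From mathcomp Require Import ring lra zify.

(* The map [rho] is a gradient: its differential is symmetric, because
   [wedge (u_k) (u_i) / (a_i - a_k)] is.  The quadratic form [energy] of this
   differential is nonnegative, and vanishes only on the affine functions of the
   roots; this is proved by Gaussian elimination, a pivot being positive by
   Chebyshev's inequality since, by convexity of the polygon, the signs of
   [wedge (u_k) (u_i)] change only once in the cyclic order starting at [i].

   Immersion: if the differential maps [z] into the translations [wedge r (u _)],
   then [r] is a multiple of [sum_k a_k u_k], the translation obtained from
   [z = a ^ 2]; hence [z] is a quadratic polynomial in the roots, which is an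
   infinitesimal Moebius transformation.

   Embedding: the translations are orthogonal to the vectors [v] with
   [sum_k v_k u_k = 0], and every Moebius class meets the affine subspace of the
   [a] with given [sum_k a_k u_k] (move the pole, by the intermediate value
   theorem).  On the convex set of ordered roots in this subspace [rho] is strictly
   monotone, so it is injective modulo translations with continuous inverse. *)

Set Implicit Arguments.
Unset Strict Implicit.
Unset Printing Implicit Defensive.

Import Order.TTheory GRing.Theory Num.Theory.
Import numFieldNormedType.Exports.

Local Open Scope ring_scope.

(** * Plane vectors *)

(** The weights of the energy have both signs, so it is not nonnegative term by term. It survives
    elimination because its weights are a skew form of rank two divided by a difference:
    [1/(n - y) - 1/(n - x)] is proportional to [y - x], so a Schur complement only replaces the
    vectors. The real work is to show that the new vectors are again in convex cyclic order, in a
    weak sense, since distinct roots of one edge give parallel vectors. Roots of one edge may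
    coincide: these are the corners of the moduli space. The coefficient of their logarithm is zero,
    so nothing becomes singular there; but elimination needs distinct points, so coinciding roots
    must be merged before it. Moebius transformations have three parameters, matched by the two
    components of [sum_k a_k u_k] and the position of one root. Affine maps change the moment only
    by a scalar factor; its direction has to be corrected by moving the pole. The moduli space is
    not compact, so injectivity alone gives no continuous inverse. Monotonicity along segments
    replaces properness: what holds on a small compact sphere around a tuple persists beyond it. *)

Lemma wedgeC (R : comPzRingType) (u v : R * R) : wedge v u = - wedge u v.
Proof. by rewrite /wedge opprB mulrC [v.2 * _]mulrC. Qed.

Lemma wedgevv (R : comPzRingType) (u : R * R) : wedge u u = 0.
Proof. by rewrite /wedge mulrC subrr. Qed.

Section Wedge.
Variable R : realFieldType.
Implicit Types u v w z : R * R.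

Lemma pair_neq0 u : (u != 0) = (u.1 != 0) || (u.2 != 0).
Proof. by case: u => x y; rewrite xpair_eqE negb_and. Qed.

Lemma wedge_parallel v u w :
  v != 0 -> wedge u v = 0 -> wedge v w = 0 -> wedge u w = 0.
Proof.
rewrite pair_neq0 /wedge => nz h1 h2; case/orP: nz => nz; apply: (mulIf nz).
  have -> : (u.1 * w.2 - u.2 * w.1) * v.1 =
    u.1 * (v.1 * w.2 - v.2 * w.1) - w.1 * (u.2 * v.1 - u.1 * v.2) by ring.
  by rewrite h2 -[_ - u.1 * v.2]opprB h1; ring.
have -> : (u.1 * w.2 - u.2 * w.1) * v.2 =
    u.2 * (v.1 * w.2 - v.2 * w.1) + w.2 * (u.1 * v.2 - u.2 * v.1) by ring.
by rewrite h2 h1; ring.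
Qed.

Lemma wedge_plucker u v w z :
  wedge w z * wedge u v + wedge u z * wedge v w + wedge v z * wedge w u = 0.
Proof. by rewrite /wedge; ring. Qed.

Definition codirectional u v := exists2 c, 0 < c & v = (c * u.1, c * u.2).

(** Parallel vectors are compared through their wedges with a third one: the factor is
    [wedge v z / wedge u z], and [z] serves to read off its sign. *)
Lemma codirectionalP u v z :
  wedge u v = 0 -> wedge u z != 0 -> 0 < wedge u z * wedge v z -> codirectional u v.
Proof.
move=> uv uz uzvz; exists (wedge v z / wedge u z).
  rewrite (_ : _ / _ = (wedge u z * wedge v z) / (wedge u z) ^+ 2).
    by rewrite divr_gt0 // exprn_even_gt0.
  by field.
have E1 : v.1 * wedge u z = wedge v z * u.1 + z.1 * wedge u v by rewrite /wedge; ring.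
have E2 : v.2 * wedge u z = wedge v z * u.2 + z.2 * wedge u v by rewrite /wedge; ring.
rewrite uv mulr0 addr0 in E1; rewrite uv mulr0 addr0 in E2.
by rewrite [LHS]surjective_pairing; congr pair; apply: (mulIf uz);
  rewrite ?E1 ?E2; field.
Qed.

End Wedge.

(** * Chebyshev's inequality for weights of sum zero *)

Section Chebyshev.
Variable R : realFieldType.

(** The positive part [P] and the negative part [N] of the weights have the same total mass [S], and
    [S] times the sum is the double sum of [N i * P j * (f j - f i)], in which no term is
    negative. *)
Lemma sum_mulr_gt0 (I : eqType) (s : seq I) (p f : I -> R) :
  \sum_(i <- s) p i = 0 -> (exists2 i, i \in s & p i != 0) ->
  {in s &, forall i j, p i < 0 -> 0 < p j -> f i < f j} ->
  0 < \sum_(i <- s) p i * f i.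
Proof.
move=> p0 [i0 si0 pi0] pf.
pose P i := Num.max (p i) 0; pose N i := Num.max (- p i) 0.
have pE i : p i = P i - N i.
  by rewrite /P /N; case: (leP (p i) 0) => h; case: (leP (- p i) 0) => h' /=; lra.
have P0 i : 0 <= P i by rewrite le_max lexx orbT.
have N0 i : 0 <= N i by rewrite le_max lexx orbT.
pose S := \sum_(i <- s) P i.
have SN : S = \sum_(i <- s) N i.
  apply/eqP; rewrite -subr_eq0 -sumrB -[X in _ == X]p0.
  by apply/eqP; apply: eq_bigr => i _; rewrite -pE.
have term i j : i \in s -> j \in s -> 0 <= N i * P j * (f j - f i).
  move=> si sj; rewrite /N /P; case: (leP (- p i) 0) => hi; first by rewrite !mul0r.
  case: (leP (p j) 0) => hj; first by rewrite mulr0 mul0r.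
  by rewrite !mulr_ge0 // ?ltW // subr_gt0 pf // -oppr_gt0.
have pos (F : I -> R) : (forall i, 0 <= F i) -> (exists2 i, i \in s & 0 < F i) ->
    0 < \sum_(i <- s) F i.
  move=> F0 [i si Fi]; rewrite lt_neqAle sumr_ge0 // andbT eq_sym psumr_eq0 //.
  by apply/allPn; exists i; rewrite // gt_eqF.
have S0 : 0 < S.
  move: pi0; rewrite neq_lt => /orP[neg|pos0].
    by rewrite SN; apply: pos => //; exists i0; rewrite // lt_max oppr_gt0 neg.
  by apply: pos => //; exists i0; rewrite // lt_max pos0.
have exP : exists2 j, j \in s & 0 < P j.
  apply/hasP; apply: contraT; rewrite -all_predC => /allP h.
  suff : S = 0 by move=> h0; rewrite h0 ltxx in S0.
  rewrite /S big_seq big1 // => j sj; apply/eqP.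
  by have := h _ sj; rewrite /= -leNgt eq_le P0 andbT.
have exN : exists2 j, j \in s & 0 < N j.
  apply/hasP; apply: contraT; rewrite -all_predC => /allP h.
  suff : S = 0 by move=> h0; rewrite h0 ltxx in S0.
  rewrite SN big_seq big1 // => j sj; apply/eqP.
  by have := h _ sj; rewrite /= -leNgt eq_le N0 andbT.
have E : S * \sum_(i <- s) p i * f i =
    \sum_(i <- s) \sum_(j <- s) N i * P j * (f j - f i).
  transitivity (\sum_(i <- s) (N i * (\sum_(j <- s) P j * f j) - N i * f i * S)).
    rewrite sumrB -!mulr_suml -SN [X in _ = _ - X]mulrC -mulrBr -sumrB.
    by congr (_ * _); apply: eq_bigr => i _; rewrite {1}pE mulrBl.
  apply: eq_bigr => i _; rewrite /S !mulr_sumr -sumrB.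
  by apply: eq_bigr => j _; ring.
rewrite -(pmulr_rgt0 _ S0) E.
have [i si Ni] := exN; have [j sj Pj] := exP.
have ge0 i' : i' \in s -> 0 <= \sum_(j' <- s) N i' * P j' * (f j' - f i').
  by move=> si'; rewrite big_seq sumr_ge0 // => j' sj'; apply: term.
rewrite lt_neqAle eq_sym big_seq sumr_ge0 // andbT psumr_eq0 //.
apply/allPn; exists i; rewrite // si /= big_seq psumr_eq0; last by move=> *; apply: term.
apply/allPn; exists j; rewrite // sj /= gt_eqF // !mulr_gt0 // subr_gt0 pf //.
  by move: Ni; rewrite lt_max ltxx orbF oppr_gt0.
by move: Pj; rewrite lt_max ltxx orbF.
Qed.
End Chebyshev.

(** * The energy of a convex system *)

(** Meant for the wedges of three vectors in cyclic order: the angles between them add up to one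
    full turn, so at most one of them exceeds a half turn. *)
Definition at_most_one_neg (R : realDomainType) (x y z : R) :=
  [/\ ~ (x < 0 /\ y < 0), ~ (y < 0 /\ z < 0) & ~ (z < 0 /\ x < 0)].

Section ConvexSystem.
Variable R : realFieldType.
Implicit Types (s : seq R) (U : R -> R * R) (v : R -> R).

(* The vectors [U x], in increasing order of [x], are the edges of a convex
   polygon in cyclic order; several consecutive ones may be parallel. *)
Record convex_system s U : Prop := ConvexSystem {
  convex_sum1 : \sum_(x <- s) (U x).1 = 0;
  convex_sum2 : \sum_(x <- s) (U x).2 = 0;
  convex_neq0 : {in s, forall x, U x != 0};
  convex_turn : forall x y z, x \in s -> y \in s -> z \in s -> x < y -> y < z ->
    at_most_one_neg (wedge (U x) (U y)) (wedge (U y) (U z)) (wedge (U z) (U x));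
  convex_codir : forall x y z, x \in s -> y \in s -> z \in s -> x < y -> y < z ->
    codirectional (U x) (U z) -> codirectional (U x) (U y);
  convex_nondeg : (2 < size s)%N ->
    exists x y, [/\ x \in s, y \in s & wedge (U x) (U y) != 0]
}.

(** The form of a weighted graph Laplacian, each pair counted in both orders; the weights are
    symmetric, as numerator and denominator both change sign, but not all nonnegative. *)
Definition energy s U v : R :=
  \sum_(x <- s) \sum_(y <- s) wedge (U x) (U y) / (y - x) * (v x - v y) ^+ 2.

Lemma sum_wedge_eq0 (I : Type) (s : seq I) (U : I -> R * R) u :
  \sum_(x <- s) (U x).1 = 0 -> \sum_(x <- s) (U x).2 = 0 ->
  \sum_(x <- s) wedge (U x) u = 0.
Proof. by move=> s1 s2; rewrite /wedge sumrB -!mulr_suml s1 s2 !mul0r subr0. Qed.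

Lemma three_distinct (T : eqType) (s : seq T) : uniq s -> (2 < size s)%N ->
  exists a b c, [/\ a \in s, b \in s, c \in s & [&& a != b, a != c & b != c]].
Proof.
case: s => [|a [|b [|c s]]] //= us _; exists a, b, c.
rewrite !inE !eqxx !orbT; split=> //.
by move: us; rewrite !inE !negb_or -!andbA => /and5P[-> -> _ ->].
Qed.

(* The matrix of [energy], with entries [- wedge (U x) (U y) / (y - x)] off the
   diagonal, has a Schur complement of the same shape: eliminating the largest
   index [n] moves [U x] along [U n], by shears that increase with [x]. *)
Section Elimination.
Variables (n : R) (s : seq R) (U : R -> R * R).
Hypothesis sn : {in s, forall x, x < n}.
Hypothesis Us : uniq s.
Hypothesis CS : convex_system (n :: s) U.
Hypothesis ss : (2 < size (n :: s))%N.

Let t x := wedge (U x) (U n).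
Let C x := t x / (n - x).
Let D := \sum_(x <- s) C x.
Let U' x := ((U x).1 + C x / D * (U n).1, (U x).2 + C x / D * (U n).2).

Let inn : n \in n :: s. Proof. exact: mem_head. Qed.
Let ins x : x \in s -> x \in n :: s. Proof. by move=> h; rewrite inE h orbT. Qed.

Let t_sum : \sum_(x <- s) t x = 0.
Proof.
have := sum_wedge_eq0 (U n) (convex_sum1 CS) (convex_sum2 CS).
by rewrite big_cons wedgevv add0r.
Qed.

Let t_neq0 : exists2 x, x \in s & t x != 0.
Proof.
apply/hasP; apply: contraT; rewrite -all_predC => /allP h.
have t0 x : x \in n :: s -> t x = 0.
  rewrite inE => /orP[/eqP->|xs]; first exact: wedgevv.
  by have /= := h _ xs; rewrite negbK => /eqP.
have [x [y [xs ys]]] := convex_nondeg CS ss.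
rewrite (wedge_parallel (convex_neq0 CS inn) (t0 _ xs)) ?eqxx //.
by rewrite wedgeC; have := t0 _ ys; rewrite /t => ->; rewrite oppr0.
Qed.

Let turn x y : x \in s -> y \in s -> x < y ->
  [/\ (t y < 0 -> t x <= 0), (t y < 0 -> 0 <= wedge (U x) (U y))
    & (0 < t x -> 0 <= wedge (U x) (U y))].
Proof.
move=> xs ys xy.
have [] := convex_turn CS (ins xs) (ins ys) inn xy (sn ys).
rewrite -/(t y) (wedgeC (U x)) -/(t x) !oppr_lt0 => h1 h2 h3.
by split=> h; rewrite leNgt; apply/negP => h'; [apply: h2|apply: h1|apply: h3].
Qed.

(** Chebyshev's inequality with weights [t] and the function [1 / (n - x)], increasing below [n]: by
    convexity the [x] with [t x < 0] precede those with [t x > 0]. *)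
Lemma pivot_gt0 : 0 < D.
Proof.
apply: sum_mulr_gt0 => // x y xs ys tx ty.
rewrite ltf_pV2 ?posrE ?subr_gt0 ?sn // ltrD2l ltrN2 ltNge; apply/negP.
rewrite le_eqVlt => /orP[/eqP yx|yx]; first by rewrite yx ltNge (ltW tx) in ty.
by have [/(_ tx)] := turn ys xs yx; rewrite leNgt ty.
Qed.

Let gap x : x \in s -> n - x != 0.
Proof. by move=> xs; rewrite subr_eq0 gt_eqF // sn. Qed.

Let wedge_pivot x : wedge (U' x) (U n) = t x.
Proof. by rewrite /t /wedge /U' /=; ring. Qed.

Let U'_fix x : t x = 0 -> U' x = U x.
Proof. by move=> tx; rewrite /U' /C tx !mul0r !addr0 -surjective_pairing. Qed.

(** The factor [y - x] comes from the difference of [1 / (n - y)] and [1 / (n - x)]. It cancels the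
    denominator of the energy and leaves the correction [C x * C y / D] of a Schur complement. *)
Let wedge_elim x y : x \in s -> y \in s ->
  wedge (U' x) (U' y) =
  wedge (U x) (U y) + (y - x) / ((n - x) * (n - y) * D) * (t x * t y).
Proof.
move=> xs ys.
have -> : wedge (U' x) (U' y) = wedge (U x) (U y) + (C y * t x - C x * t y) / D.
  by rewrite /t /wedge /U' /=; ring.
congr (_ + _); rewrite /C; field.
by rewrite (gt_eqF pivot_gt0) !gap.
Qed.

Let coef_gt0 x y : x \in s -> y \in s -> x < y ->
  0 < (y - x) / ((n - x) * (n - y) * D).
Proof.
by move=> xs ys xy; rewrite divr_gt0 ?mulr_gt0 ?subr_gt0 ?sn ?pivot_gt0.
Qed.

Let wedge_elim_gt0 x y : x \in s -> y \in s -> x < y -> 0 < t x * t y ->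
  0 < wedge (U' x) (U' y).
Proof.
move=> xs ys xy txy; rewrite wedge_elim // ltr_wpDl //; last first.
  by rewrite mulr_gt0 ?coef_gt0.
have [_ h1 h2] := turn xs ys xy.
have : t x != 0 by apply: contraTneq txy => ->; rewrite mul0r ltxx.
rewrite neq_lt => /orP[tx|]; last exact: h2.
by apply: h1; rewrite nmulr_rgt0 in txy.
Qed.

Let wedge_elim0 x y : x \in s -> y \in s -> t x * t y = 0 ->
  wedge (U' x) (U' y) = wedge (U x) (U y).
Proof. by move=> xs ys h; rewrite wedge_elim // h mulr0 addr0. Qed.

(** Shears along [U n] preserve [t], the side of the line of [U n]. For [x < y] the wedge becomes
    positive if both vectors are strictly on the same side, decreases if they are on opposite sides,
    and is unchanged if one of them is on the line. With the Plucker relation this decides all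
    cases. *)
Lemma convex_elimination : convex_system s U'.
Proof.
split.
(* The shear coefficients [C x / D] add up to one, so together the shears make up for the removed
   vector [U n]. *)
- rewrite big_split /= -!mulr_suml -/D divff ?gt_eqF ?pivot_gt0 // mul1r addrC.
  by have := convex_sum1 CS; rewrite big_cons.
- rewrite big_split /= -!mulr_suml -/D divff ?gt_eqF ?pivot_gt0 // mul1r addrC.
  by have := convex_sum2 CS; rewrite big_cons.
- move=> x xs; apply/eqP => h; have := wedge_pivot x.
  rewrite h /wedge /= !mul0r subrr => /esym /U'_fix h'.
  by have := convex_neq0 CS (ins xs); rewrite -h' h eqxx.
- move=> x y z xs ys zs xy yz; have xz := lt_trans xy yz.
  have [A1 A2 A3] := convex_turn CS (ins xs) (ins ys) (ins zs) xy yz.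
  (* With [U n] as fourth vector the coefficients of the three new wedges are [t z], [t x] and
     [t y]. Their signs exclude two negative wedges when [x], [y], [z] are spread over both sides of
     the line of [U n]. *)
  have P' := wedge_plucker (U' x) (U' y) (U' z) (U n).
  rewrite !wedge_pivot in P'.
  have [pat_xy nxy pxy] := turn xs ys xy.
  have [pat_yz nyz pyz] := turn ys zs yz.
  have [pat_xz nxz pxz] := turn xs zs xz.
  have E := wedge_elim0.
  have zx0 : t x * t z = 0 -> wedge (U' z) (U' x) = wedge (U z) (U x).
    by move=> h; rewrite E // mulrC.
  have ge0 a b : a \in s -> b \in s -> a < b -> t a * t b >= 0 ->
      (t a != 0) && (t b != 0) || (0 <= wedge (U a) (U b)) -> 0 <= wedge (U' a) (U' b).
    move=> sa sb ab; rewrite le_eqVlt => /orP[/eqP h|h _]; last by rewrite ltW ?wedge_elim_gt0.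
    rewrite E // -negb_or -mulf_eq0 -h eqxx //=.
  case: (ltgtP (t y) 0) => ty.
  + have tx := pat_xy ty.
    have wxy : 0 <= wedge (U' x) (U' y).
      by apply: ge0; rewrite ?nxy ?orbT // -mulrNN mulr_ge0 // oppr_ge0 // ltW.
    split=> -[h1 h2]; [by rewrite ltNge wxy in h1| |by rewrite ltNge wxy in h2].
    case: (ltgtP (t z) 0) => tz.
    * by move: h1; rewrite ltNge ge0 // ?nyz ?orbT // -mulrNN mulr_ge0 // oppr_ge0 ltW.
    * have e1 : 0 <= t z * wedge (U' x) (U' y) by rewrite mulr_ge0 // ltW.
      have e2 : 0 <= t x * wedge (U' y) (U' z) by rewrite -mulrNN mulr_ge0 // oppr_ge0 // ltW.
      have e3 : 0 < t y * wedge (U' z) (U' x) by rewrite -mulrNN mulr_gt0 // oppr_gt0.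
      by move: P' e1 e2 e3; lra.
    * by apply: A2; move: h1 h2; rewrite E ?zx0 ?tz ?mulr0.
  + have tz : 0 <= t z by rewrite leNgt; apply/negP => /pat_yz; rewrite leNgt ty.
    have wyz : 0 <= wedge (U' y) (U' z).
      by apply: ge0; rewrite ?pyz ?orbT // mulr_ge0 // ltW.
    split=> -[h1 h2]; [by rewrite ltNge wyz in h2|by rewrite ltNge wyz in h1|].
    case: (ltgtP (t x) 0) => tx.
    * have e1 : t z * wedge (U' x) (U' y) <= 0 by rewrite mulr_ge0_le0 // ltW.
      have e2 : t x * wedge (U' y) (U' z) <= 0 by rewrite mulr_le0_ge0 // ltW.
      have e3 : t y * wedge (U' z) (U' x) < 0 by rewrite pmulr_rlt0.
      by move: P' e1 e2 e3; lra.
    * by move: h2; rewrite ltNge ge0 // ?pxy ?orbT // mulr_ge0 // ltW.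
    * by apply: A3; move: h1 h2; rewrite (E x y) ?zx0 ?tx ?mul0r.
  + have Exy : wedge (U' x) (U' y) = wedge (U x) (U y) by rewrite E // ty mulr0.
    have Eyz : wedge (U' y) (U' z) = wedge (U y) (U z) by rewrite E // ty mul0r.
    case: (leP (t x * t z) 0) => txz.
      have le : wedge (U z) (U x) <= wedge (U' z) (U' x).
        rewrite wedgeC (wedgeC (U' x)) lerN2 wedge_elim // gerDl.
        by rewrite mulr_ge0_le0 // ltW // coef_gt0.
      rewrite Exy Eyz; split=> // -[h1 h2].
        by apply: A2; split=> //; apply: le_lt_trans h2.
      by apply: A3; split=> //; apply: le_lt_trans h1.
    (* Here [U y] is on the line of [U n], while [U x] and [U z] are strictly on the same side. The
       old turning condition leaves only codirectional [U x] and [U z] with a different direction at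
       [y] between them, which [convex_codir] forbids. *)
    exfalso.
    have tx0 : t x != 0 by apply: contraTneq txz => ->; rewrite mul0r ltxx.
    have tz0 : t z != 0 by apply: contraTneq txz => ->; rewrite mulr0 ltxx.
    have y0 := convex_neq0 CS (ins ys).
    have wxy0 : wedge (U x) (U y) != 0.
      by apply: contraNneq tx0 => h; apply/eqP; apply: wedge_parallel y0 h ty.
    have P := wedge_plucker (U x) (U y) (U z) (U n).
    rewrite -/(t x) -/(t y) -/(t z) ty mul0r addr0 in P.
    have opp : wedge (U x) (U y) * wedge (U y) (U z) < 0.
      have : 0 < (t z * wedge (U x) (U y)) ^+ 2 by rewrite exprn_even_gt0 //= mulf_neq0.
      rewrite expr2 {2}(_ : t z * _ = - (t x * wedge (U y) (U z))); last by apply/eqP; rewrite -addr_eq0 P.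
      rewrite (_ : _ * _ = - (t x * t z) * (wedge (U x) (U y) * wedge (U y) (U z))); last by ring.
      by rewrite nmulr_rgt0 // oppr_lt0.
    have wzx : 0 <= wedge (U z) (U x).
      rewrite leNgt; apply/negP => h.
      case: (ltP (wedge (U x) (U y)) 0) => h1; first exact: A3.
      by apply: A2; split=> //; rewrite ltNge; apply/negP => h2; move: opp; rewrite ltNge mulr_ge0.
    have wxz : 0 <= wedge (U x) (U z).
      case: (ltgtP (t x) 0) (tx0) => // tx _; last exact: pxz.
      by apply: nxz; rewrite nmulr_rgt0 in txz.
    have wxz0 : wedge (U x) (U z) = 0.
      by apply/eqP; rewrite eq_le wxz andbT -oppr_ge0 -wedgeC.
    have [c c0 Uy] := convex_codir CS (ins xs) (ins ys) (ins zs) xy yz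
       (codirectionalP wxz0 tx0 txz).
    move: ty; rewrite /t Uy (_ : wedge _ _ = c * t x); last by rewrite /t /wedge /=; ring.
    by move/eqP; rewrite mulf_eq0 (negPf tx0) gt_eqF.
- move=> x y z xs ys zs xy yz [c c0 Uz]; have xz := lt_trans xy yz.
  have tz : t z = c * t x.
    by rewrite -!wedge_pivot Uz /wedge /=; ring.
  (* Off the line of [U n], codirectional vectors would be on the same side and have positive wedge.
     So both are on the line and have not been moved. *)
  have [tx|tx] := eqVneq (t x) 0; last first.
    have : 0 < wedge (U' x) (U' z).
      by apply: wedge_elim_gt0; rewrite // tz mulrCA mulr_gt0 // -expr2 exprn_even_gt0.
    rewrite Uz (_ : wedge _ _ = 0) ?ltxx //.
    by rewrite /wedge /=; ring.
  rewrite tx mulr0 in tz; rewrite (U'_fix tx) (U'_fix tz) in Uz *.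
  have cod : codirectional (U x) (U z) by exists c.
  have [d d0 Uy] := convex_codir CS (ins xs) (ins ys) (ins zs) xy yz cod.
  suff ty : t y = 0 by exists d; rewrite // U'_fix.
  transitivity (d * t x); last by rewrite tx mulr0.
  by rewrite /t Uy /wedge /=; ring.
- move=> s2.
  have [/hasP[x xs /eqP tx]|/hasPn noz] := boolP (has (fun x => t x == 0) s).
    have [y ys ty] := t_neq0; exists x, y; split=> //.
    rewrite wedge_elim0 ?tx ?mul0r //; apply: contraNneq ty => h; apply/eqP.
    by apply: (wedge_parallel (convex_neq0 CS (ins xs))) => //; rewrite wedgeC h oppr0.
  (* When no vector is on the line of [U n], two of any three are on the same side, and the wedge of
     these two has become nonzero. *)
  have same x y : x \in s -> y \in s -> x != y -> 0 < t x * t y ->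
      exists x y, [/\ x \in s, y \in s & wedge (U' x) (U' y) != 0].
    move=> xs ys xy h; exists x, y; split=> //.
    move: xy; rewrite neq_lt => /orP[xy|yx]; first by rewrite gt_eqF // wedge_elim_gt0.
    by rewrite wedgeC oppr_eq0 gt_eqF // wedge_elim_gt0 // mulrC.
  have pig (a b c : R) : a != 0 -> b != 0 -> c != 0 -> [\/ 0 < a * b, 0 < a * c | 0 < b * c].
    have nn (x y : R) : x < 0 -> y < 0 -> 0 < x * y by move=> *; rewrite nmulr_rgt0.
    have pp (x y : R) : 0 < x -> 0 < y -> 0 < x * y by move=> *; rewrite pmulr_rgt0.
    rewrite !neq_lt => /orP[ha|ha] /orP[hb|hb] /orP[hc|hc];
      by [constructor 1; auto|constructor 2; auto|constructor 3; auto].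
  have [a [b [c [na nb nc /and3P[h1 h2 h3]]]]] := three_distinct Us s2.
  by case: (pig _ _ _ (noz _ na) (noz _ nb) (noz _ nc)) => h;
    [apply: (same a b)|apply: (same a c)|apply: (same b c)].
Qed.

(** Completing the square in [v n]: the optimal value is the mean of [v] with weights [C x / D]. The
    factor 2 comes from counting each pair in both orders. *)
Lemma energy_elimination v :
  energy (n :: s) U v = energy s U' v + 2 * D * (v n - (\sum_(x <- s) C x * v x) / D) ^+ 2.
Proof.
have D0 : D != 0 by rewrite gt_eqF ?pivot_gt0.
have E x y : x \in s -> y \in s ->
   wedge (U' x) (U' y) / (y - x) * (v x - v y) ^+ 2 =
   wedge (U x) (U y) / (y - x) * (v x - v y) ^+ 2
   + D^-1 * (C x * C y * (v x - v y) ^+ 2).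
  move=> xs ys; have [->|xy] := eqVneq x y; first by rewrite !subrr expr0n /= !mulr0 addr0.
  rewrite wedge_elim // /C; field.
  by rewrite D0 !gap // subr_eq0 eq_sym.
rewrite /energy.
have -> : \sum_(x <- s) \sum_(y <- s) wedge (U' x) (U' y) / (y - x) * (v x - v y) ^+ 2 =
  \sum_(x <- s) \sum_(y <- s) wedge (U x) (U y) / (y - x) * (v x - v y) ^+ 2
  + D^-1 * \sum_(x <- s) \sum_(y <- s) C x * C y * (v x - v y) ^+ 2.
  rewrite big_distrr -big_split /= big_seq [RHS]big_seq; apply: eq_bigr => x xs.
  rewrite big_distrr -big_split /= big_seq [RHS]big_seq; apply: eq_bigr => y ys.
  exact: E.
pose A := \sum_(x <- s) C x * v x; pose B := \sum_(x <- s) C x * (v x) ^+ 2.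
have -> : \sum_(x <- s) \sum_(y <- s) C x * C y * (v x - v y) ^+ 2 =
   2 * (D * B) - 2 * A ^+ 2.
  transitivity (\sum_(x <- s) (C x * v x ^+ 2 * D - 2 * (C x * v x) * A + C x * B)).
    apply: eq_bigr => x _; rewrite /D /A /B !mulr_sumr -sumrB -big_split /=.
    by apply: eq_bigr => y _; ring.
  rewrite big_split sumrB /= -!mulr_suml -mulr_sumr -/A -/B -/D; ring.
have split1 : \sum_(x <- s) C x * (v x - v n) ^+ 2 = B - 2 * v n * A + v n ^+ 2 * D.
  rewrite /A /B /D !mulr_sumr -sumrB -big_split /=; apply: eq_bigr => x _; ring.
rewrite big_cons big_cons !subrr expr0n /= mulr0 add0r.
under [X in _ + X = _]eq_bigr do rewrite big_cons.
rewrite big_split /=.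
have -> : \sum_(y <- s) wedge (U n) (U y) / (y - n) * (v n - v y) ^+ 2 =
   \sum_(x <- s) C x * (v x - v n) ^+ 2.
  rewrite big_seq [RHS]big_seq; apply: eq_bigr => y ys; rewrite /C /t (wedgeC (U y)).
  by field; rewrite gap // subr_eq0 lt_eqF // sn.
rewrite split1 -/A; field; exact: D0.
Qed.

End Elimination.

Theorem energy_ge0 s U v : sorted >%R s -> convex_system s U ->
  0 <= energy s U v /\
  (energy s U v = 0 -> exists c d, {in s, forall x, v x = c + d * x}).
Proof.
have gt_trans : transitive (>%R : rel R) by move=> y x z h1 h2; apply: lt_trans h1.
elim: s U => [|n s IH] U.
  by move=> _ _; rewrite /energy big_nil; split => // _; exists 0, 0.
move=> srt CS.
have sn : {in s, forall x, x < n}.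
  by move=> x xs; have /allP/(_ _ xs) := order_path_min gt_trans srt.
have us : uniq s by apply: (sorted_uniq gt_trans _ (path_sorted srt)) => x; exact: ltxx.
(* At most two vectors of sum zero are parallel, so the energy vanishes; correspondingly, any
   function on at most two points is affine. *)
have [ss|] := ltnP 2 (size (n :: s)); last first.
  case: s sn us srt CS {IH} => [|x [|//]] sn us srt CS _.
    rewrite /energy !big_cons !big_nil !subrr expr0n /= !mulr0 !addr0; split=> // _.
    by exists (v n), 0 => y; rewrite inE => /eqP ->; rewrite mul0r addr0.
  have xn : n - x != 0 by rewrite subr_eq0 gt_eqF // sn // mem_head.
  have Un : wedge (U n) (U x) = 0.
    have h1 := convex_sum1 CS; have h2 := convex_sum2 CS.
    rewrite !big_cons big_nil addr0 in h1; rewrite !big_cons big_nil addr0 in h2.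
    rewrite /wedge (_ : (U n).1 = - (U x).1); last by apply/eqP; rewrite -addr_eq0 h1.
    rewrite (_ : (U n).2 = - (U x).2); last by apply/eqP; rewrite -addr_eq0 h2.
    by ring.
  have Un' : wedge (U x) (U n) = 0 by rewrite wedgeC Un oppr0.
  split; first by rewrite /energy !big_cons !big_nil Un Un' !wedgevv !mul0r !addr0.
  move=> _; exists (v x - (v n - v x) / (n - x) * x), ((v n - v x) / (n - x)) => y.
  by rewrite !inE => /orP[] /eqP ->; field.
have [e0 e1] := IH _ (path_sorted srt) (convex_elimination sn us CS ss).
have D0 := pivot_gt0 sn CS ss.
rewrite energy_elimination //; set D := \sum_(x <- s) _ in D0 *; set q := (_ - _) ^+ 2.
have q0 : 0 <= 2 * D * q by rewrite mulr_ge0 ?sqr_ge0 // mulr_ge0 // ltW.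
split; first by rewrite addr_ge0.
move=> /eqP; rewrite paddr_eq0 // => /andP[/eqP /e1[c [d vE]]].
rewrite mulf_eq0 mulf_eq0 pnatr_eq0 (gt_eqF D0) /= sqrf_eq0 subr_eq0 => /eqP vn.
exists c, d => x; rewrite inE => /orP[/eqP ->|/vE//].
have t0 := sum_wedge_eq0 (U n) (convex_sum1 CS) (convex_sum2 CS).
rewrite big_cons wedgevv add0r in t0.
rewrite vn; apply: (mulIf (lt0r_neq0 D0)); rewrite mulfVK ?lt0r_neq0 //.
(* Since [t y = C y * (n - y)] has sum zero, [n] is the mean of the other points with weights
   [C y / D]: an affine [v] on them extends to [n] with the value required by the square. *)
transitivity (\sum_(y <- s) wedge (U y) (U n) / (n - y) * v y +
  d * \sum_(y <- s) wedge (U y) (U n)); first by rewrite t0 mulr0 addr0.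
rewrite /D !mulr_sumr -big_split /=.
rewrite big_seq [RHS]big_seq; apply: eq_bigr => y ys; rewrite vE //; field.
by rewrite subr_eq0 gt_eqF // sn.
Qed.

End ConvexSystem.

(** * Edges of a lattice polygon *)

Lemma val_iter_ordS n (i : 'I_n) j : (iter j (@ordS n) i : nat) = ((i + j) %% n)%N.
Proof.
elim: j => [|j IH] /=; first by rewrite addn0 modn_small.
by rewrite IH -addn1 modnDml addn1 addnS.
Qed.

Section PolygonEdges.
Variable P : lattice_polygon.
Implicit Types i k l : 'I_(nb_edges P).

Lemma edge_wedge_vertex i k : k != i -> k != ordS i ->
  0 < wedge (edge i) (vertex k - vertex i).
Proof. exact: vertex_convex. Qed.

Lemma edge_wedge_vertex_ge0 i k : 0 <= wedge (edge i) (vertex k - vertex i).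
Proof.
have [->|ki] := eqVneq k i; first by rewrite subrr /wedge /= !mulr0 subrr.
have [->|kSi] := eqVneq k (ordS i); first by rewrite /wedge mulrC subrr.
by rewrite ltW // edge_wedge_vertex.
Qed.

Lemma ordS_neq i : ordS i != i.
Proof.
have m3 := nb_edges_ge3 P; have im := ltn_ord i.
apply/eqP => /(congr1 val) /=.
have [h|h] := eqVneq i.+1 (nb_edges P); first by rewrite h modnn; lia.
by rewrite modn_small; lia.
Qed.

Lemma ordSS_neq i : ordS (ordS i) != i.
Proof.
have m3 := nb_edges_ge3 P; have im := ltn_ord i.
apply/eqP => /(congr1 val) /=; rewrite -addn1 modnDml addn1.
have [|h] := ltnP i.+2 (nb_edges P); first by move=> h; rewrite modn_small; lia.
rewrite (_ : i.+2 = (i.+2 - nb_edges P) + nb_edges P)%N; last by lia.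
by rewrite modnDr modn_small; lia.
Qed.

Lemma wedge_edge_succ i : 0 < wedge (edge i) (edge (ordS i)).
Proof.
have := edge_wedge_vertex (ordSS_neq i) (ordS_neq (ordS i)).
by rewrite (_ : wedge _ _ = wedge (edge i) (edge (ordS i))) // /edge /wedge /=; ring.
Qed.

Lemma edge_neq0 i : edge i != 0.
Proof.
by apply/eqP => h; have := wedge_edge_succ i; rewrite h /wedge /= !mul0r subrr ltxx.
Qed.

Lemma edge_length_gt0 i : (0 < edge_length i)%N.
Proof.
rewrite /edge_length gcdn_gt0 !lt0n !absz_eq0.
have := edge_neq0 i; case: (edge i) => x y /=.
by rewrite xpair_eqE negb_and.
Qed.

(* Along the boundary the linear form [wedge (edge k)] increases and then decreases. *)
Lemma wedge_edge_neg_succ k l : ordS l != k -> ordS l != ordS k ->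
  wedge (edge k) (edge l) < 0 -> wedge (edge k) (edge (ordS l)) < 0.
Proof.
set x := ordS l => xk xSk neg; rewrite ltNge; apply/negP => pos.
have h1 := edge_wedge_vertex xk xSk.
have h2 := edge_wedge_vertex_ge0 l k.
have h3 := edge_wedge_vertex_ge0 x k.
have h4 := wedge_edge_succ l.
(* If the form [wedge (edge k)] decreased along [l] but not along [x], the vertex [x] would minimize
   it on the polygon by convexity, although [h1] makes it larger there than at the vertex [k]. *)
have E : wedge (edge l) (edge x) * wedge (edge k) (vertex x - vertex k) =
  wedge (edge x) (vertex k - vertex x) * wedge (edge k) (edge l)
  - wedge (edge l) (vertex k - vertex l) * wedge (edge k) (edge x).
  rewrite /wedge /edge -/x /=; ring.
have : 0 < wedge (edge l) (edge x) * wedge (edge k) (vertex x - vertex k).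
  by rewrite mulr_gt0.
rewrite E ltNge => /negP; apply; rewrite subr_le0.
by apply: (@le_trans _ _ 0); [rewrite mulr_ge0_le0 // ltW|rewrite mulr_ge0].
Qed.

Lemma wedge_edge_neg_iter k l j :
  (forall j', (0 < j' <= j)%N -> iter j' (@ordS _) l != k /\ iter j' (@ordS _) l != ordS k) ->
  wedge (edge k) (edge l) < 0 -> wedge (edge k) (edge (iter j (@ordS _) l)) < 0.
Proof.
elim: j => [|j IH] //= h neg.
have [h1 h2] : ordS (iter j (@ordS _) l) != k /\ ordS (iter j (@ordS _) l) != ordS k.
  by apply: (h j.+1); rewrite leqnn.
apply: wedge_edge_neg_succ => //; apply: IH => // j' /andP[j0 jj].
by apply: h; rewrite j0 ltnW.
Qed.

Lemma val_ordS_case i : (ordS i : nat) = i.+1 \/ (ordS i : nat) = 0%N /\ i.+1 = nb_edges P.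
Proof.
have im := ltn_ord i; rewrite /=.
have [h|h] := eqVneq i.+1 (nb_edges P); first by right; rewrite {1}h modnn.
by left; rewrite modn_small //; lia.
Qed.

(** A wedge that is negative stays negative while its second edge moves on, as long as this edge
    does not reach the first one. Moving it to the remaining edge of the triple gives a negative
    wedge whose reverse was also assumed negative. *)
Lemma edge_turn i k l : (i < k)%N -> (k < l)%N ->
  at_most_one_neg (wedge (edge i) (edge k)) (wedge (edge k) (edge l))
    (wedge (edge l) (edge i)).
Proof.
have im := ltn_ord i; have km := ltn_ord k; have lm := ltn_ord l.
move=> ik kl.
have iterE (x y : 'I_(nb_edges P)) j : ((y : nat) = (x + j) %% nb_edges P)%N -> y = iter j (@ordS _) x.
  by move=> h; apply: val_inj; rewrite /= val_iter_ordS.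
have neqE (x y : 'I_(nb_edges P)) : x <> y :> nat -> x != y :> 'I_(nb_edges P).
  by move=> h; apply/eqP => xy; apply: h; rewrite xy.
split=> -[h1 h2].
- have jE : i = iter (i + nb_edges P - l) (@ordS _) l.
    apply: iterE; rewrite (_ : l + _ = i + nb_edges P)%N ?modnDr ?modn_small //; lia.
  suff : wedge (edge k) (edge i) < 0 by rewrite wedgeC oppr_lt0 ltNge ltW.
  rewrite jE; apply: wedge_edge_neg_iter h2 => j' /andP[j0 jj].
  suff h : (iter j' (@ordS _) l > l)%N \/ (iter j' (@ordS _) l <= i)%N.
    by have kS := val_ordS_case k; split; apply: neqE; lia.
  rewrite val_iter_ordS; have [lt|ge] := ltnP (l + j') (nb_edges P).
    by left; rewrite modn_small //; lia.
  right; rewrite (_ : l + j' = (l + j' - nb_edges P) + nb_edges P)%N; last by lia.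
  by rewrite modnDr modn_small; lia.
- have jE : k = iter (k - i) (@ordS _) i.
    by apply: iterE; rewrite modn_small; lia.
  suff : wedge (edge l) (edge k) < 0 by rewrite wedgeC oppr_lt0 ltNge ltW.
  rewrite [in edge k]jE; apply: wedge_edge_neg_iter h2 => j' /andP[j0 jj].
  have E : iter j' (@ordS _) i = (i + j')%N :> nat by rewrite val_iter_ordS modn_small //; lia.
  by have lS := val_ordS_case l; split; apply: neqE; lia.
- have jE : l = iter (l - k) (@ordS _) k.
    by apply: iterE; rewrite modn_small; lia.
  suff : wedge (edge i) (edge l) < 0 by rewrite wedgeC oppr_lt0 ltNge ltW.
  rewrite [in edge l]jE; apply: wedge_edge_neg_iter h2 => j' /andP[j0 jj].
  have E : iter j' (@ordS _) k = (k + j')%N :> nat by rewrite val_iter_ordS modn_small //; lia.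
  by have iS := val_ordS_case i; split; apply: neqE; lia.
Qed.

(** Codirectional edges have the polygon on the same side, so they lie on one supporting line.
    Strict convexity then makes each the successor of the other, impossible with three edges or
    more. Proportionality is tested by wedges because the factors are real and the edges
    integral. *)
Lemma wedge_edge_inj (R : realDomainType) (a b : R) i k : 0 < a -> 0 < b ->
  (forall z, (wedge (edge i) z)%:~R * a = (wedge (edge k) z)%:~R * b) -> i = k.
Proof.
move=> a0 b0 E; apply/eqP; apply: contraT => ik.
have h1 := edge_wedge_vertex_ge0 i k; have h2 := edge_wedge_vertex_ge0 k i.
have h3 : wedge (edge k) (vertex i - vertex k) = - wedge (edge k) (vertex k - vertex i).
  by rewrite /wedge /=; ring.
have h4 : wedge (edge k) (vertex k - vertex i) = 0.
  apply/eqP; rewrite eq_le -oppr_ge0 -h3 h2 /=.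
  by rewrite -(ler0z R) -(pmulr_lge0 _ b0) -E pmulr_lge0 // ler0z.
have h5 : wedge (edge i) (vertex k - vertex i) = 0.
  have /eqP := E (vertex k - vertex i).
  by rewrite h4 mul0r mulf_eq0 intr_eq0 (gt_eqF a0) orbF => /eqP.
have kSi : k = ordS i.
  by apply/eqP; apply: contraT => h; have := edge_wedge_vertex (_ : k != i) h; rewrite eq_sym h5 ltxx => /(_ ik).
have iSk : i = ordS k.
  apply/eqP; apply: contraT => h; have := edge_wedge_vertex ik h.
  by rewrite h3 h4 oppr0 ltxx.
by have := ordSS_neq i; rewrite -kSi -iSk eqxx.
Qed.

End PolygonEdges.

(** * Normals *)

Section Normals.
Variables (R : realType) (P : lattice_polygon).
Implicit Types i k l : 'I_(nb_edges P).
Notation normal := (@normal R P).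

Lemma edge_normal i :
  ((edge i).1%:~R = (edge_length i)%:R * (normal i).2 :> R) *
  ((edge i).2%:~R = - ((edge_length i)%:R * (normal i).1) :> R).
Proof.
have d1 : ((edge_length i)%:Z %| (edge i).1)%Z by rewrite dvdzE /= dvdn_gcdl.
have d2 : ((edge_length i)%:Z %| (edge i).2)%Z by rewrite dvdzE /= dvdn_gcdr.
rewrite /normal /inner_normal /= mulrNz mulrN opprK.
by split; rewrite mulrC -[_%:R]/((edge_length i)%:Z%:~R) -intrM divzK.
Qed.

Lemma wedge_normal i k : ((wedge (edge i) (edge k))%:~R : R) =
  (edge_length i)%:R * (edge_length k)%:R * wedge (normal i) (normal k).
Proof.
rewrite /wedge mulrzBr !intrM !edge_normal; ring.
Qed.

Lemma length_gt0 i : 0 < (edge_length i)%:R :> R.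
Proof. by rewrite ltr0n edge_length_gt0. Qed.

Lemma wedge_normal_lt0 i k :
  (wedge (normal i) (normal k) < 0) = (wedge (edge i) (edge k) < 0).
Proof.
by rewrite -(ltrz0 R) wedge_normal pmulr_rlt0 // mulr_gt0 ?length_gt0.
Qed.

Lemma normal_turn i k l : (i < k)%N -> (k < l)%N ->
  at_most_one_neg (wedge (normal i) (normal k)) (wedge (normal k) (normal l))
    (wedge (normal l) (normal i)).
Proof.
by move=> ik kl; rewrite /at_most_one_neg !wedge_normal_lt0; apply: edge_turn.
Qed.

Lemma wedge_normal_succ i : 0 < wedge (normal i) (normal (ordS i)).
Proof.
have := wedge_edge_succ i; rewrite -(ltr0z R) wedge_normal pmulr_rgt0 //.
by rewrite mulr_gt0 ?length_gt0.
Qed.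

Lemma normal_neq0 i : normal i != 0.
Proof.
by apply/eqP => h; have := wedge_normal_succ i; rewrite h /wedge /= !mul0r subrr ltxx.
Qed.

Lemma codirectional_normal i k : codirectional (normal i) (normal k) -> i = k.
Proof.
move=> [c c0 nE]; have n1 : (normal k).1 = c * (normal i).1 by rewrite nE.
have n2 : (normal k).2 = c * (normal i).2 by rewrite nE.
apply: (@wedge_edge_inj _ R (c * (edge_length k)%:R) (edge_length i)%:R).
- by rewrite mulr_gt0 ?length_gt0.
- exact: length_gt0.
move=> z; rewrite /wedge !mulrzBr !intrM !edge_normal n1 n2; ring.
Qed.

(* In all three cases [i], [k], [l] are in cyclic order. *)
Lemma normal_pattern i k l :
  wedge (normal k) (normal i) < 0 -> 0 < wedge (normal l) (normal i) ->
  [\/ (k < l)%N /\ (l < i)%N, (i < k)%N /\ (k < l)%N | (l < i)%N /\ (i < k)%N].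
Proof.
move=> ki li.
have ik : 0 < wedge (normal i) (normal k) by rewrite wedgeC oppr_gt0.
have il : wedge (normal i) (normal l) < 0 by rewrite wedgeC oppr_lt0.
have kl : k != l :> nat.
  by apply/eqP => /val_inj kl; move: ki; rewrite kl ltNge ltW.
have k_i : k != i :> nat.
  by apply/eqP => /val_inj h; move: ki; rewrite h wedgevv ltxx.
have l_i : l != i :> nat.
  by apply/eqP => /val_inj h; move: li; rewrite h wedgevv ltxx.
have [lk|lk] : (l < k)%N \/ (k < l)%N by lia.
  have [kli|[lik|ilk]] : (k < i)%N \/ (l < i < k)%N \/ (i < l)%N by lia.
  - by have [_ h _] := normal_turn lk kli; case: h.
  - by constructor 3; apply/andP.
  - by have [_ _ h] := normal_turn ilk lk; case: h.
have [li'|[kil|ik']] : (l < i)%N \/ (k < i < l)%N \/ (i < k)%N by lia.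
- by constructor 1.
- by case/andP: kil => h1 h2; have [h _ _] := normal_turn h1 h2; case: h.
- by constructor 2.
Qed.

End Normals.

(** * The energy of a tuple of roots *)

Section RootEnergy.
Variables (R : realType) (P : lattice_polygon).
Notation I := (root_index P).
Implicit Types (a v : I -> R) (al be : I).

Definition root_normal al : R * R := normal R (tag al).
Local Notation u := root_normal.

Definition tag_increasing a :=
  forall al be, (tag al < tag be)%N -> a al < a be.

Definition root_energy a v :=
  \sum_al \sum_be wedge (u al) (u be) / (a be - a al) * (v al - v be) ^+ 2.

Lemma increasing_tag_eq a al be : tag_increasing a -> a al = a be -> tag al = tag be.
Proof.
move=> sa e; apply: ord_inj; by case: (ssrnat.ltngtP (tag al) (tag be)) => // h; have := sa _ _ h; rewrite e ltxx.
Qed.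

Lemma increasing_tag_le a al be : tag_increasing a -> a al < a be -> (tag al <= tag be)%N.
Proof. by move=> sa h; rewrite leqNgt; apply/negP => h'; have := sa _ _ h'; rewrite ltNge ltW. Qed.

Lemma root_sum (F : forall i, 'I_(edge_length i) -> R) :
  \sum_i \sum_j F i j = \sum_(al : I) F (tag al) (tagged al).
Proof. exact: (sig_big_dep xpredT (fun=> xpredT) F). Qed.

Lemma root_normal_sum : (\sum_al (u al).1 = 0) /\ (\sum_al (u al).2 = 0).
Proof.
have [s1 s2] := normal_sum R P.
by split; [exact: etrans (esym (root_sum (fun i _ => (normal R i).1))) s1|exact: etrans (esym (root_sum (fun i _ => (normal R i).2))) s2].
Qed.

Lemma wedge_root_sum w : \sum_al wedge (u al) w = 0.
Proof. by apply: sum_wedge_eq0; case: root_normal_sum. Qed.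

Definition first_root i : I := Tagged _ (Ordinal (edge_length_gt0 i)).

Lemma wedge_root_neq0 al : exists be, wedge (u be) (u al) != 0.
Proof.
exists (first_root (ordS (tag al))); rewrite wedgeC oppr_eq0 gt_eqF //.
exact: wedge_normal_succ.
Qed.

(** The function [1 / (a al - x)] is negative and increasing to the right of its pole, positive and
    increasing to the left. Hence it increases along the cyclic order that starts just after [al],
    in which the negative weights come before the positive ones. *)
Lemma root_pivot_gt0 a al : tag_increasing a ->
  0 < \sum_be wedge (u be) (u al) / (a al - a be).
Proof.
move=> sa; apply: sum_mulr_gt0 => [|//|].
- exact: wedge_root_sum.
- by have [be h] := wedge_root_neq0 al; exists be => //; rewrite mem_index_enum.
move=> be ga _ _ hb hg.
have [[h1 h2]|[h1 h2]|[h1 h2]] := normal_pattern hb hg.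
- have l1 := sa _ _ h1; have l2 := sa _ _ h2; have l3 := lt_trans l1 l2.
  by rewrite ltf_pV2 ?posrE ?subr_gt0 // ltrD2l ltrN2.
- have l1 := sa _ _ h1; have l2 := sa _ _ h2; have l3 := lt_trans l1 l2.
  by rewrite ltf_nV2 ?negrE ?subr_lt0 // ltrD2l ltrN2.
- have l1 := sa _ _ h1; have l2 := sa _ _ h2.
  by apply: (@lt_trans _ _ 0); rewrite ?invr_lt0 ?invr_gt0 ?subr_lt0 ?subr_gt0.
Qed.

(* Coinciding roots lie on one edge; they are replaced by a single one, with the
   sum of the normals and the mean of the values of [v]. *)
Section Merge.
Variable a : I -> R.
Hypothesis sa : tag_increasing a.

Let s : seq R := rev (sort <=%R (undup [seq a al | al <- enum I])).
Let U x : R * R := (\sum_(al | a al == x) (u al).1, \sum_(al | a al == x) (u al).2).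
Let cnt x : R := (#|[pred al | a al == x]|)%:R.

Let in_s al : a al \in s.
Proof. by rewrite mem_rev mem_sort mem_undup map_f // mem_enum. Qed.

Let sP x : x \in s -> exists al, x = a al.
Proof. by rewrite mem_rev mem_sort mem_undup => /mapP[al _ ->]; exists al. Qed.

Let uniq_s : uniq s. Proof. by rewrite rev_uniq sort_uniq undup_uniq. Qed.

Lemma merge_sorted : sorted >%R s.
Proof. by rewrite rev_sorted lt_sorted_uniq_le sort_uniq undup_uniq sort_le_sorted. Qed.

Let UE al : U (a al) = (cnt (a al) * (u al).1, cnt (a al) * (u al).2).
Proof.
rewrite /U /cnt; congr pair.
  rewrite (eq_bigr (fun=> (u al).1)) ?sumr_const ?mulr_natl // => be /eqP e.
  by rewrite /u (increasing_tag_eq sa e).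
rewrite (eq_bigr (fun=> (u al).2)) ?sumr_const ?mulr_natl // => be /eqP e.
by rewrite /u (increasing_tag_eq sa e).
Qed.

Let cnt_gt0 al : 0 < cnt (a al).
Proof.
by rewrite ltr0n; apply/card_gt0P; exists al; rewrite inE.
Qed.

Let sum_fiber (F : I -> R) : \sum_al F al = \sum_(x <- s) \sum_(al | a al == x) F al.
Proof.
under [RHS]eq_bigr do rewrite big_mkcond.
rewrite exchange_big /=; apply: eq_bigr => al _.
rewrite (bigD1_seq (a al)) ?in_s //= eqxx big1 ?addr0 // => x.
by rewrite eq_sym => /negPf ->.
Qed.

Let wedgeU al be : wedge (U (a al)) (U (a be)) =
  cnt (a al) * cnt (a be) * wedge (u al) (u be).
Proof. by rewrite !UE /wedge /=; ring. Qed.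

Let U_lt0 al be : (wedge (U (a al)) (U (a be)) < 0) = (wedge (u al) (u be) < 0).
Proof. by rewrite wedgeU pmulr_rlt0 // mulr_gt0 // cnt_gt0. Qed.

Lemma merge_convex : convex_system s U.
Proof.
have [s1 s2] := root_normal_sum.
split.
- by rewrite /U /= -sum_fiber.
- by rewrite /U /= -sum_fiber.
- move=> x /sP[al ->]; rewrite UE pair_neq0 /= !mulf_eq0 !(gt_eqF (cnt_gt0 al)) /=.
  by have := normal_neq0 R (tag al); rewrite pair_neq0.
- move=> x y z /sP[al ->] /sP[be ->] /sP[ga ->] xy yz.
  have t1 := increasing_tag_le sa xy; have t2 := increasing_tag_le sa yz.
  rewrite /at_most_one_neg !U_lt0.
  have nn (e : R) (w : R) : w = - e -> ~ (e < 0 /\ w < 0).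
    by move=> -> [h1]; rewrite oppr_lt0 ltNge ltW.
  move: t1; rewrite leq_eqVlt => /orP[/eqP /val_inj e|t1].
    rewrite /u e wedgevv ltxx; split=> -[] //.
    by move=> h1 h2; apply: (nn _ _ (wedgeC (normal R (tag be)) (normal R (tag ga)))).
  move: t2; rewrite leq_eqVlt => /orP[/eqP /val_inj e|t2].
    rewrite /u e wedgevv ltxx; split=> -[] //.
    by move=> h1 h2; apply: (nn _ _ (wedgeC (normal R (tag ga)) (normal R (tag al)))).
  exact: normal_turn.
- move=> x y z /sP[al ->] /sP[be ->] /sP[ga ->] xy yz [c c0].
  have t1 := increasing_tag_le sa xy; have t2 := increasing_tag_le sa yz.
  rewrite !UE => eU.
  have e1 : cnt (a ga) * (u ga).1 = c * (cnt (a al) * (u al).1) := congr1 fst eU.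
  have e2 : cnt (a ga) * (u ga).2 = c * (cnt (a al) * (u al).2) := congr1 snd eU.
  have tE : tag al = tag ga.
    apply: (@codirectional_normal R); exists (c * cnt (a al) / cnt (a ga)).
      by rewrite !mulr_gt0 ?invr_gt0 ?cnt_gt0.
    rewrite [LHS]surjective_pairing; have g0 := lt0r_neq0 (cnt_gt0 ga).
    by congr pair; apply: (mulfI g0); rewrite ?e1 ?e2 /u; field.
  have tE' : tag be = tag al by apply: val_inj; apply/eqP; rewrite eqn_leq t1 tE t2.
  exists (cnt (a be) / cnt (a al)); first by rewrite divr_gt0 ?cnt_gt0.
  have g0 := lt0r_neq0 (cnt_gt0 al).
  by rewrite /= /u tE'; congr pair; field.
- move=> _; pose i := Ordinal (leq_trans (isT : 0 < 3)%N (nb_edges_ge3 P)).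
  exists (a (first_root i)), (a (first_root (ordS i))); split=> //.
  by rewrite wedgeU !mulf_neq0 ?lt0r_neq0 ?cnt_gt0 // wedge_normal_succ.
Qed.

Variable v : I -> R.
Let V x := (\sum_(al | a al == x) v al) / cnt x.
Let z al := v al - V (a al).

Let z_fiber (G : R -> R) : \sum_al z al * G (a al) = 0.
Proof.
rewrite sum_fiber big_seq big1 // => x /sP[ga ->].
rewrite (eq_bigr (fun al => z al * G (a ga))) => [|al /eqP -> //].
rewrite -mulr_suml (eq_bigr (fun al => v al - V (a ga))) => [|al /eqP e]; last by rewrite /z e.
rewrite sumrB sumr_const -mulr_natr -/(cnt _) /V mulfVK ?subrr ?mul0r //.
exact: lt0r_neq0.
Qed.

(** Decomposition of [v] into its mean on each set of coinciding roots and the deviation [z] from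
    it. The deviation has sum zero on each such set while the weights are constant there, so all
    products linear in some [z al] disappear and only the squares remain, with the pivots as
    coefficients. *)
Lemma root_energy_merge :
  root_energy a v = energy s U V +
    2 * \sum_al (\sum_be wedge (u be) (u al) / (a al - a be)) * (z al) ^+ 2.
Proof.
pose k al be := wedge (u al) (u be) / (a be - a al).
have kC al be : k be al = k al be by rewrite /k wedgeC -[X in _ / X]opprB invrN mulrNN.
have kE al be ga : a al = a ga -> k al be = k ga be.
  by move=> e; rewrite /k /u e (increasing_tag_eq sa e).
have EV : energy s U V = \sum_al \sum_be k al be * (V (a al) - V (a be)) ^+ 2.
  rewrite /energy [RHS]sum_fiber big_seq [RHS]big_seq; apply: eq_bigr => x /sP[ga ->].
  symmetry.
  rewrite (eq_bigr (fun al => \sum_(y <- s) wedge (u ga) (U y) / (y - a ga) * (V (a ga) - V y) ^+ 2)).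
    rewrite sumr_const -mulr_natl -/(cnt _) mulr_sumr big_seq [RHS]big_seq.
    apply: eq_bigr => y /sP[be ->]; rewrite !UE /wedge /=; ring.
  move=> al /eqP e; rewrite [LHS]sum_fiber big_seq [RHS]big_seq.
  apply: eq_bigr => y /sP[be ->].
  rewrite (eq_bigr (fun=> k ga be * (V (a ga) - V (a be)) ^+ 2)).
    by rewrite sumr_const -mulr_natl -/(cnt _) UE /k /wedge /=; ring.
  by move=> be' /eqP e'; rewrite e e' (kE _ _ _ e) kC (kE _ _ _ e') kC.
(* A function that is constant on coinciding roots factors through their common value: [G] evaluates
   it at a chosen root, and [z_fiber] applies. *)
have zz (H : I -> I -> R) : (forall al be ga, a al = a ga -> H be al = H be ga) ->
    forall be, \sum_al z al * H be al = 0.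
  move=> HE be; pose G x := if [pick al | a al == x] is Some al then H be al else 0.
  rewrite -[RHS](z_fiber G); apply: eq_bigr => al _; congr (_ * _).
  rewrite /G; case: pickP => [ga /eqP e|/(_ al)]; last by rewrite eqxx.
  exact: HE.
rewrite /root_energy EV.
have vE al : v al = V (a al) + z al by rewrite /z addrC subrK.
have exp al be : k al be * (v al - v be) ^+ 2 =
   k al be * (V (a al) - V (a be)) ^+ 2
   + (k al be * z al ^+ 2 + k al be * z be ^+ 2)
   + ((z al * (2 * k al be * (V (a al) - V (a be))))
      - (z be * (2 * k al be * (V (a al) - V (a be)) + 2 * k al be * z al))).
  by rewrite !vE; ring.
under eq_bigr => al _ do (under eq_bigr => be _ do rewrite -/(k al be) exp).
under eq_bigr do rewrite !big_split sumrN /=.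
rewrite !big_split sumrN /=; rewrite -[LHS]addrA; congr (_ + _).
rewrite [X in _ + (X - _)]exchange_big [X in _ + (X - _)]big1 /=; last first.
  move=> be _.
  apply: (zz (fun be al => 2 * k al be * (V (a al) - V (a be)))) => al be' ga e.
  by rewrite (kE _ _ _ e) e.
rewrite [X in _ + (_ - X)]big1; last first.
  move=> al _; apply: (zz (fun be al => 2 * k be al * (V (a be) - V (a al)) + 2 * k be al * z be)).
  move=> be be' ga e.
  by rewrite kC (kE _ _ _ e) kC e.
rewrite subrr addr0 [X in _ + X]exchange_big /= mulr_sumr -big_split /=.
apply: eq_bigr => al _; rewrite -!mulr_suml.
have -> : \sum_be wedge (u be) (u al) / (a al - a be) = \sum_be k al be.
  by apply: eq_bigr => be _; rewrite -kC.
ring.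
Qed.

End Merge.

Theorem root_energy_ge0 a v : tag_increasing a ->
  0 <= root_energy a v /\
  (root_energy a v = 0 -> exists c d, forall al, v al = c + d * a al).
Proof.
move=> sa; rewrite root_energy_merge //.
set s := rev _; set U := fun x => _; set V := fun x => _; set F := \sum_al _.
have [e0 e1] := energy_ge0 V (merge_sorted a) (merge_convex sa).
have F0 al : 0 <= (\sum_be wedge (u be) (u al) / (a al - a be)) * (v al - V (a al)) ^+ 2.
  by rewrite mulr_ge0 ?sqr_ge0 ?ltW ?root_pivot_gt0.
have F1 : 0 <= F by apply: sumr_ge0.
split; first by rewrite addr_ge0 // mulr_ge0.
move=> /eqP; rewrite paddr_eq0 ?mulr_ge0 // => /andP[/eqP /e1[c [d vE]]].
rewrite mulf_eq0 pnatr_eq0 /= psumr_eq0 // => /allP h; exists c, d => al.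
have := h al (mem_index_enum _); rewrite mulf_eq0 gt_eqF ?root_pivot_gt0 //=.
rewrite sqrf_eq0 subr_eq0 => /eqP ->; apply: vE.
by rewrite mem_rev mem_sort mem_undup map_f // mem_enum.
Qed.
End RootEnergy.

Local Open Scope classical_set_scope.

(** * Smooth functions of vectors *)

Section SmoothCalculus.
Variable R : realType.

(** The difference of the two functions vanishes near [x], so it is differentiable there with
    differential zero. *)
Lemma near_eq_differentiable (V W : normedModType R) (f g : V -> W) (x : V) :
  {near x, f =1 g} -> differentiable f x -> differentiable g x.
Proof.
move=> fg df; pose e := g - f.
have de : differentiable e x.
  have fg0 : \forall h \near 0, f (h + x) = g (h + x).
    have : \forall y \near x, f y = g y by exact: fg.
    by rewrite (near_shift 0) subr0; apply: filterS => h; rewrite /= addrC.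
  have E : e \o shift x = cst (e x) + (\0 : V -> W) +o_ 0 id.
    apply/eqaddoP => _/posnumP[eps]; near=> h.
    rewrite /e /cst /= !fctE (nbhs_singleton fg) (near fg0 h)//.
    by rewrite /= !subrr addr0 subr0 normr0 mulr_ge0.
  have d0 : 'd e x = (\0 : {linear V -> W}) :> (V -> W).
    apply: diff_unique => //; exact: cst_continuous.
  apply/diff_locallyP; rewrite d0; split=> //; exact: cst_continuous.
rewrite (_ : g = f + e); first exact: differentiableD.
by apply/funext => y; rewrite /e !fctE addrC subrK.
Unshelve. all: by end_near. Qed.

Lemma Ck_on_eq (V W : normedModType R) (U : set V) r (f g : V -> W) : open U ->
  (forall x, U x -> f x = g x) -> Ck_on r U f -> Ck_on r U g.
Proof.
move=> oU; elim: r f g => [|r IH] f g fg /=.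
  move=> fc x Ux; have nfg : {near x, f =1 g}.
    by apply: filterS (open_nbhs_nbhs (conj oU Ux)) => y; apply: fg.
  suff : g @ x --> g x by [].
  rewrite -(fg x Ux); apply: cvg_trans (fc x Ux).
  by apply: near_eq_cvg; apply: filterS nfg => y ->.
move=> [df Df]; split=> [x Ux|v].
  apply: near_eq_differentiable (df x Ux).
  by apply: filterS (open_nbhs_nbhs (conj oU Ux)) => y; apply: fg.
apply: IH (Df v) => x Ux; apply: near_eq_derive.
by apply: filterS (open_nbhs_nbhs (conj oU Ux)) => y; apply: fg.
Qed.

Lemma is_derive_ln_norm (y : R) : y != 0 -> is_derive y 1 (fun z : R => ln `|z|) y^-1.
Proof.
rewrite neq_lt => /orP[y0|y0].
  apply: (@near_eq_is_derive _ _ _ (fun z => ln (- z))).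
    near=> z; rewrite ltr0_norm //; near: z; exact: lt_nbhsl.
  have ny : 0 < - y by rewrite oppr_gt0.
  have h := is_derive1_ln ny.
  rewrite (_ : y^-1 = (- y)^-1 * -1); last by rewrite invrN mulrN1 opprK.
  exact: is_derive1_comp h (is_deriveNid y 1).
apply: (@near_eq_is_derive _ _ _ (fun z => ln z)).
  near=> z; rewrite gtr0_norm //; near: z; exact: lt_nbhsr.
exact: is_derive1_ln.
Unshelve. all: by end_near. Qed.

Lemma differentiable_ln_norm (V : normedModType R) (f : V -> R) x : differentiable f x -> f x != 0 ->
  differentiable (fun y => ln `|f y|) x.
Proof.
move=> df f0; apply: (@differentiable_comp _ _ _ _ f (fun z => ln `|z|) x df).
by apply/derivable1_diffP; have h := is_derive_ln_norm f0; apply: ex_derive.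
Qed.

Lemma derive_ln_norm (V : normedModType R) (f : V -> R) x v : differentiable f x -> f x != 0 ->
  'D_v (fun y => ln `|f y|) x = (f x)^-1 * 'D_v f x.
Proof.
move=> df f0; have h := is_derive_ln_norm f0.
have dl : differentiable (fun z : R => ln `|z|) (f x).
  by apply/derivable1_diffP; apply: ex_derive.
rewrite (deriveE v df) (deriveE v (differentiable_ln_norm df f0)).
by rewrite (diff_comp df dl) /= (diff1E dl) derive1E derive_val mulrC.
Qed.

Section Elementary.
Variables (n : nat) (U : set 'rV[R]_n).

(* This class is closed under directional derivatives. *)
Inductive elementary : ('rV[R]_n -> R) -> Prop :=
| elementary_cst c : elementary (fun=> c)
| elementary_coord i : elementary (fun x => x ord0 i)
| elementaryD f g : elementary f -> elementary g -> elementary (fun x => f x + g x)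
| elementaryM f g : elementary f -> elementary g -> elementary (fun x => f x * g x)
| elementaryV f : elementary f -> (forall x, U x -> f x != 0) ->
    elementary (fun x => (f x)^-1)
| elementary_ln f : elementary f -> (forall x, U x -> f x != 0) ->
    elementary (fun x => ln `|f x|).

Lemma elementary_sum (I : Type) (s : seq I) (F : I -> 'rV[R]_n -> R) :
  (forall i, elementary (F i)) -> elementary (fun x => \sum_(i <- s) F i x).
Proof.
move=> eF; elim: s => [|i s IH].
  rewrite (_ : (fun _ => _) = fun=> 0); first exact: elementary_cst.
  by apply/funext => x; rewrite big_nil.
rewrite (_ : (fun _ => _) = fun x => F i x + \sum_(j <- s) F j x).
  exact: elementaryD.
by apply/funext => x; rewrite big_cons.
Qed.

Lemma elementaryN f : elementary f -> elementary (fun x => - f x).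
Proof.
move=> ef; rewrite (_ : (fun _ => _) = fun x => -1 * f x).
  by apply: elementaryM => //; apply: elementary_cst.
by apply/funext => x; rewrite mulN1r.
Qed.

Lemma elementaryB f g : elementary f -> elementary g ->
  elementary (fun x => f x - g x).
Proof. by move=> ef eg; apply: elementaryD => //; apply: elementaryN. Qed.

Lemma elementary_differentiable f : elementary f ->
  (forall x, U x -> differentiable f x) /\
  (forall v, exists2 g, elementary g & forall x, U x -> 'D_v f x = g x).
Proof.
elim=> {f}.
- move=> c; split=> // v; exists (fun=> 0); first exact: elementary_cst.
  by move=> x _; rewrite derive_cst.
- move=> i; split=> [x _|v]; first exact: differentiable_coord.
  exists (fun=> v ord0 i); first exact: elementary_cst.
  move=> x _; have := derive_mx (@derivable_id _ _ x v : derivable (id : _ -> 'rV[R]_n) x v).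
  by rewrite derive_id => /rowP/(_ i); rewrite mxE.
- move=> f g ef [df Df] eg [dg Dg]; split=> [x Ux|v].
    by apply: differentiableD; [apply: df|apply: dg].
  have [f' ef' f'E] := Df v; have [g' eg' g'E] := Dg v.
  exists (fun x => f' x + g' x); first exact: elementaryD.
  move=> x Ux; rewrite deriveD ?f'E ?g'E //.
    by apply: diff_derivable; apply: df.
  by apply: diff_derivable; apply: dg.
- move=> f g ef [df Df] eg [dg Dg]; split=> [x Ux|v].
    by apply: differentiableM; [apply: df|apply: dg].
  have [f' ef' f'E] := Df v; have [g' eg' g'E] := Dg v.
  exists (fun x => f x * g' x + g x * f' x).
    by apply: elementaryD; apply: elementaryM.
  move=> x Ux; rewrite deriveM ?f'E ?g'E //.
    by apply: diff_derivable; apply: df.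
  by apply: diff_derivable; apply: dg.
- move=> f ef [df Df] f0; split=> [x Ux|v].
    by apply: differentiableV; [apply: df|apply: f0].
  have [f' ef' f'E] := Df v.
  exists (fun x => - ((f x)^-1 * (f x)^-1) * f' x).
    by apply: elementaryM => //; apply: elementaryN; apply: elementaryM; apply: elementaryV.
  move=> x Ux; rewrite deriveV ?f'E ?f0 //; last by apply: diff_derivable; apply: df.
  by rewrite -invfM -expr2.
- move=> f ef [df Df] f0; split=> [x Ux|v].
    by apply: differentiable_ln_norm; [apply: df|apply: f0].
  have [f' ef' f'E] := Df v.
  exists (fun x => (f x)^-1 * f' x); first by apply: elementaryM => //; apply: elementaryV.
  by move=> x Ux; rewrite -f'E // derive_ln_norm ?f0 //; apply: df.
Qed.

End Elementary.

(** The directional derivatives of the coordinates agree with elementary functions on [U] only; as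
    [U] is open, [Ck_on_eq] exchanges one for the other before the induction hypothesis is
    applied. *)
Lemma Ck_on_elementary n k (U : set 'rV[R]_n) r (f : 'rV[R]_n -> 'rV[R]_k) : open U ->
  (forall j, elementary U (fun x => f x ord0 j)) -> Ck_on r U f.
Proof.
move=> oU.
have dif (g : 'rV[R]_n -> 'rV[R]_k) : (forall j, elementary U (fun x => g x ord0 j)) ->
    forall x, U x -> differentiable g x.
  move=> eg x Ux.
  rewrite (_ : g = \sum_j (fun y => g y ord0 j *: delta_mx ord0 j)); last first.
    by apply/funext => y; rewrite fct_sumE [LHS]row_sum_delta.
  apply: differentiable_sum => j; apply: differentiableZl.
  by have [h _] := elementary_differentiable (eg j); apply: h.
elim: r f => [|r IH] f ef /=.
  by move=> x Ux; apply: differentiable_continuous; apply: dif.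
split=> [|v]; first exact: dif.
have Dg j : exists g, elementary U g /\ forall x, U x -> 'D_v (fun x => f x ord0 j) x = g x.
  by have [_ /(_ v)[g]] := elementary_differentiable (ef j); exists g.
have [g gE] := choice Dg.
apply: (@Ck_on_eq _ _ U _ (fun x => \row_j g j x)) => //.
  move=> x Ux; rewrite derive_mx; last by apply: diff_derivable; apply: dif.
  apply/rowP => j; rewrite !mxE; have [_ h] := gE j; rewrite -h //.
apply: IH => j; have [h _] := gE j; rewrite (_ : (fun _ => _) = g j) //.
by apply/funext => x; rewrite mxE.
Qed.

Lemma smooth_on_elementary n k (U : set 'rV[R]_n) (f : 'rV[R]_n -> 'rV[R]_k) : open U ->
  (forall j, elementary U (fun x => f x ord0 j)) -> smooth_on U f.
Proof. by move=> oU ef; split=> // r; apply: Ck_on_elementary. Qed.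

End SmoothCalculus.

(** * Root tuples and Moebius transformations *)

Section RootVectors.
Variables (R : realType) (P : lattice_polygon).
Notation n := (nb_boundary_points P).
Notation I := (root_index P).
Notation m := (nb_edges P).
Implicit Types (a b w : 'rV[R]_n) (al be : I).

Definition coordinate w al : R := w ord0 (enum_rank al).
Local Notation "w .[: al ]" := (coordinate w al) (at level 2, format "w .[: al ]").
Local Notation u := (@root_normal R P).

Definition vector_of (f : I -> R) : 'rV[R]_n := \row_x f (enum_val x).

Lemma vector_ofE f al : (vector_of f).[: al] = f al.
Proof. by rewrite /coordinate mxE enum_rankK. Qed.

Lemma coordinateP a b : (forall al, a.[: al] = b.[: al]) -> a = b.
Proof.
by move=> ab; apply/rowP => x; rewrite -(enum_valK x); apply: ab.
Qed.

Lemma coordinate_surj (Q : 'I_n -> Prop) : (forall al : I, Q (enum_rank al)) -> forall x, Q x.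
Proof. by move=> h x; rewrite -(enum_valK x). Qed.

Lemma of_entriesE f al : (of_entries f).[: al] = f (tag al) (tagged al) :> R.
Proof. by case: al => i j; rewrite -[LHS]/(entry _ j) of_entriesK. Qed.

(** The sum may run over all roots: those on the edge of [al], excluded in [rho], have coefficient
    zero. *)
Lemma rhoE a al :
  (rho a).[: al] = \sum_be wedge (u be) (u al) * ln `|a.[: al] - a.[: be]|.
Proof.
case: al => i j; rewrite of_entriesE /=.
transitivity (\sum_k \sum_(l < edge_length k)
    wedge (normal R k) (normal R i) * ln `|entry a j - entry a l|); last first.
  by rewrite root_sum; apply: eq_bigr => -[k l].
rewrite [RHS](bigD1 i) //= [X in _ = X + _]big1 ?add0r // => l _.
by rewrite wedgevv mul0r.
Qed.

Lemma translateE r w al : (translate r w).[: al] = w.[: al] + wedge r (u al).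
Proof.
by case: al => i j; rewrite of_entriesE /shift /wedge /=; congr (_ + _); rewrite mulrC [X in _ - X]mulrC.
Qed.

Lemma harnack_rootsP a : harnack_roots a <-> tag_increasing (coordinate a) /\
  forall i (j l : 'I_(edge_length i)), (j <= l)%N ->
     a.[: Tagged _ j] <= a.[: Tagged _ l].
Proof.
split=> -[h1 h2].
  by split=> // -[i j] [k l]; apply: h2.
by split=> // i k j l ik; apply: (h1 (Tagged _ j) (Tagged _ l)).
Qed.

Lemma harnack_increasing a : harnack_roots a -> tag_increasing (coordinate a).
Proof. by case/harnack_rootsP. Qed.

Lemma moebius_relatedI (p q r s : R) a b : 0 < p * s - q * r ->
  (forall al, r * a.[: al] + s != 0 /\
     b.[: al] = (p * a.[: al] + q) / (r * a.[: al] + s)) -> moebius_related a b.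
Proof.
move=> det H; pose c := Num.sqrt (p * s - q * r).
have c0 : c != 0 by rewrite lt0r_neq0 // sqrtr_gt0.
have cc : c * c = p * s - q * r by rewrite -expr2 sqr_sqrtr // ltW.
exists (p / c), (q / c), (r / c), (s / c); split.
  have -> : p / c * (s / c) - q / c * (r / c) = (p * s - q * r) / (c * c) by field.
  by rewrite cc divff // lt0r_neq0.
apply: coordinate_surj => al; have [h1 h2] := H al; rewrite -!/(coordinate _ al).
have E : r / c * a.[: al] + s / c = (r * a.[: al] + s) / c by field.
split; first by rewrite E mulf_neq0 ?invr_eq0.
rewrite h2 E; field.
by rewrite c0 h1.
Qed.

(** The denominators are all positive, so no pole separates the roots, and each difference of roots
    is multiplied by a positive factor. *)
Lemma moebius_harnack (p q r s : R) a b : 0 < p * s - q * r ->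
  (forall al, 0 < r * a.[: al] + s /\
     b.[: al] = (p * a.[: al] + q) / (r * a.[: al] + s)) ->
  harnack_roots a -> harnack_roots b.
Proof.
move=> det H /harnack_rootsP[sa ma].
have E al be : b.[: be] - b.[: al] = (p * s - q * r) * (a.[: be] - a.[: al]) /
    ((r * a.[: be] + s) * (r * a.[: al] + s)).
  have [h1 ->] := H al; have [h2 ->] := H be; field.
  by rewrite !lt0r_neq0.
have D al be : 0 < (r * a.[: be] + s) * (r * a.[: al] + s).
  by have [h1 _] := H al; have [h2 _] := H be; rewrite mulr_gt0.
apply/harnack_rootsP; split=> [al be ab|i j l jl].
  by rewrite -subr_gt0 E divr_gt0 // mulr_gt0 // subr_gt0 sa.
by rewrite -subr_ge0 E divr_ge0 ?(ltW (D _ _)) // mulr_ge0 ?(ltW det) // subr_ge0 ma.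
Qed.

Lemma moebius_diff a b (p q r s : R) : p * s - q * r = 1 ->
  (forall x, r * a ord0 x + s != 0 /\
     b ord0 x = (p * a ord0 x + q) / (r * a ord0 x + s)) ->
  forall al be, b.[: al] - b.[: be] =
    (a.[: al] - a.[: be]) / ((r * a.[: al] + s) * (r * a.[: be] + s)).
Proof.
move=> det H al be.
have [h1 e1] : r * a.[: al] + s != 0 /\ b.[: al] = (p * a.[: al] + q) / (r * a.[: al] + s) by exact: H.
have [h2 e2] : r * a.[: be] + s != 0 /\ b.[: be] = (p * a.[: be] + q) / (r * a.[: be] + s) by exact: H.
rewrite e1 e2 -[a.[: al] - _]mul1r -det; field.
by rewrite h1 h2.
Qed.

Lemma nb_edges_gt0 : (0 < m)%N. Proof. exact: leq_trans (nb_edges_ge3 P). Qed.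
Lemma nb_edges_gt1 : (1 < m)%N. Proof. exact: leq_trans (nb_edges_ge3 P). Qed.
Lemma nb_edges_pred : (m.-1 < m)%N. Proof. by rewrite prednK // nb_edges_gt0. Qed.

Definition edge_first := Ordinal nb_edges_gt0.
Definition edge_second := Ordinal nb_edges_gt1.
Definition edge_last := Ordinal nb_edges_pred.

Lemma edge_length_pred (i : 'I_m) : ((edge_length i).-1 < edge_length i)%N.
Proof. by rewrite prednK // edge_length_gt0. Qed.

Definition last_root i : I := Tagged _ (Ordinal (edge_length_pred i)).

(* The first and the last of the three anchors are the extremal roots: with their
   images prescribed, a Moebius transformation has its pole outside the roots. *)
Definition anchor0 := first_root edge_first.
Definition anchor1 := last_root edge_second.
Definition anchor2 := last_root edge_last.

Section HarnackRoots.
Variable a : 'rV[R]_n.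
Hypothesis Ha : harnack_roots a.

Lemma anchor01 : a.[: anchor0] < a.[: anchor1].
Proof. exact: (harnack_increasing Ha). Qed.

Lemma anchor12 : a.[: anchor1] < a.[: anchor2].
Proof.
apply: (harnack_increasing Ha) => /=; have := nb_edges_ge3 P; lia.
Qed.

Lemma anchor0_le al : a.[: anchor0] <= a.[: al].
Proof.
have /harnack_rootsP[sa ma] := Ha.
case: al => i j; have [e|ne] := eqVneq edge_first i.
  by move: j; rewrite -e => j; apply: ma.
by apply/ltW/sa => /=; rewrite lt0n; apply: contraNneq ne => e; apply/eqP/val_inj.
Qed.

Lemma anchor2_ge al : a.[: al] <= a.[: anchor2].
Proof.
have /harnack_rootsP[sa ma] := Ha.
case: al => i j; have [e|ne] := eqVneq edge_last i.
  by move: j; rewrite -e => j; apply: ma; rewrite /= -ltnS prednK // edge_length_gt0.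
apply/ltW/sa => /=; have := ltn_ord i.
have : i <> m.-1 :> nat by move=> e; move/eqP: ne; apply; apply: val_inj.
by have := nb_edges_gt0; lia.
Qed.

End HarnackRoots.

(* The Moebius transformation with values [0], [1/2] and [1] at the anchors. *)
Definition normal_num a al := (a.[: al] - a.[: anchor0]) * (a.[: anchor2] - a.[: anchor1]).
Definition normal_den a al :=
  normal_num a al + (a.[: anchor1] - a.[: anchor0]) * (a.[: anchor2] - a.[: al]).
Definition normal_form a : 'rV[R]_n :=
  vector_of (fun al => normal_num a al / normal_den a al).

Lemma normal_den_gt0 a al : harnack_roots a -> 0 < normal_den a al.
Proof.
move=> Ha; have h1 := anchor01 Ha; have h2 := anchor12 Ha.
have h3 := anchor0_le Ha al; have h4 := anchor2_ge Ha al.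
rewrite /normal_den /normal_num.
have [->|ne] := eqVneq a.[: al] a.[: anchor0].
  by rewrite subrr mul0r add0r mulr_gt0 // subr_gt0 // (lt_trans h1).
rewrite ltr_pwDl ?mulr_ge0 ?mulr_gt0 ?subr_gt0 ?subr_ge0 ?(ltW h1) //.
by rewrite lt_neqAle eq_sym ne.
Qed.

Lemma normal_form_moebius a : harnack_roots a ->
  exists p q r s, 0 < p * s - q * r /\ forall al, 0 < r * a.[: al] + s /\
     (normal_form a).[: al] = (p * a.[: al] + q) / (r * a.[: al] + s).
Proof.
move=> Ha; set A := a.[: anchor0]; set B := a.[: anchor1]; set C := a.[: anchor2].
have h1 : A < B := anchor01 Ha; have h2 : B < C := anchor12 Ha.
exists (C - B), (- A * (C - B)), ((C - B) - (B - A)), (- A * (C - B) + C * (B - A)).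
split=> [|al].
  have -> : (C - B) * (- A * (C - B) + C * (B - A)) - - A * (C - B) * (C - B - (B - A)) =
    (C - B) * (B - A) * (C - A) by ring.
  by rewrite !mulr_gt0 ?subr_gt0 // (lt_trans h1).
have E : (C - B - (B - A)) * a.[: al] + (- A * (C - B) + C * (B - A)) = normal_den a al.
  by rewrite /normal_den /normal_num -/A -/B -/C; ring.
rewrite E; split; first exact: normal_den_gt0.
by rewrite vector_ofE; congr (_ / _); rewrite /normal_num -/A -/B -/C; ring.
Qed.

Lemma normal_form_related a : harnack_roots a -> moebius_related a (normal_form a).
Proof.
move=> /normal_form_moebius[p [q [r [s [det H]]]]].
by apply: (moebius_relatedI det) => al; have [h ->] := H al; rewrite lt0r_neq0.
Qed.

Lemma normal_form_harnack a : harnack_roots a -> harnack_roots (normal_form a).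
Proof.
by move=> Ha; have [p [q [r [s [det H]]]]] := normal_form_moebius Ha;
  apply: moebius_harnack det H Ha.
Qed.

Lemma normal_form_anchor0 a : (normal_form a).[: anchor0] = 0.
Proof. by rewrite vector_ofE /normal_num subrr !mul0r. Qed.

Lemma normal_form_anchor1 a : harnack_roots a -> (normal_form a).[: anchor1] = 2^-1.
Proof.
move=> Ha; have h1 := anchor01 Ha; have h2 := anchor12 Ha.
have E : normal_den a anchor1 = normal_num a anchor1 * 2.
  by rewrite /normal_den /normal_num; ring.
have nz : normal_num a anchor1 != 0 by rewrite mulf_neq0 // subr_eq0 gt_eqF.
by rewrite vector_ofE E invfM mulrA divff // mul1r.
Qed.

Lemma normal_form_anchor2 a : harnack_roots a -> (normal_form a).[: anchor2] = 1.
Proof.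
move=> Ha; have h1 := anchor01 Ha; have h2 := anchor12 Ha.
have h3 := normal_den_gt0 anchor2 Ha.
rewrite vector_ofE -[RHS](divff (lt0r_neq0 h3)); congr (_ / _).
by rewrite /normal_den subrr mulr0 addr0.
Qed.

(** Invariance of the cross-ratio: the products of differences in numerator and denominator involve
    [al] and the three anchors once each, so a Moebius transformation divides them by the same
    [k]. *)
Lemma normal_form_eq a b : moebius_related a b -> normal_form a = normal_form b.
Proof.
move=> [p [q [r [s [det H]]]]]; apply: coordinateP => al; rewrite !vector_ofE.
have D := moebius_diff det H.
have nz be : r * a.[: be] + s != 0 by have [] := H (enum_rank be).
pose k := (r * a.[: al] + s) * (r * a.[: anchor0] + s) * (r * a.[: anchor1] + s) * (r * a.[: anchor2] + s).
have k0 : k != 0 by rewrite !mulf_neq0.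
have E1 : normal_num b al = normal_num a al / k.
  by rewrite /normal_num !D /k; field; rewrite !nz.
have E2 : normal_den b al = normal_den a al / k.
  by rewrite /normal_den E1 /normal_num !D /k; field; rewrite !nz.
by rewrite E1 E2 -mulf_div divff ?invr_eq0 // mulr1.
Qed.

End RootVectors.

(** * Gap coordinates *)

Section GapCoordinates.
Variables (R : realType) (P : lattice_polygon).
Notation n := (nb_boundary_points P).
Notation I := (root_index P).
Notation m := (nb_edges P).
Implicit Types (a b w : 'rV[R]_n) (al be : I) (c : I -> R).
Local Notation "w .[: al ]" := (coordinate w al) (at level 2, format "w .[: al ]").

Definition position al : nat := tagged al.
Local Notation pos := position.

Lemma position_lt al : (pos al < edge_length (tag al))%N.
Proof. exact: ltn_ord. Qed.

Lemma root_eq al be : tag al = tag be -> pos al = pos be -> al = be.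
Proof.
case: al => i j; case: be => k l /= e; move: l; rewrite -e => l jl.
by congr existT; apply: val_inj.
Qed.

(* Every edge has one anchor, at which the root itself is a coordinate; the other
   coordinates are the gaps between consecutive roots of an edge, so that they
   are only constrained to be nonnegative. *)
Definition is_anchor al : bool :=
  if tag al == edge_first P then pos al == 0%N
  else pos al == (edge_length (tag al)).-1.

(** The next root of the same edge in the direction of its anchor; at an anchor this is [al]
    itself. *)
Definition neighbour al : I :=
  odflt al [pick be | (tag be == tag al) &&
    (pos be == if tag al == edge_first P then (pos al).-1 else (pos al).+1)].

Lemma neighbourP al : ~~ is_anchor al ->
  tag (neighbour al) = tag al /\
  pos (neighbour al) = if tag al == edge_first P then (pos al).-1 else (pos al).+1.
Proof.
move=> nal; rewrite /neighbour; case: pickP => [be /andP[/eqP -> /eqP ->] //|].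
have lt : ((if tag al == edge_first P then (pos al).-1 else (pos al).+1)
    < edge_length (tag al))%N.
  have := position_lt al; move: nal; rewrite /is_anchor; case: ifP => _; lia.
by move=> /(_ (Tagged _ (Ordinal lt))); rewrite !eqxx.
Qed.

Definition gap b al : R :=
  if is_anchor al then b.[: al]
  else if tag al == edge_first P then b.[: al] - b.[: neighbour al]
  else b.[: neighbour al] - b.[: al].

(** The inverse of the matrix of [gap]: a root is the anchor of its edge, plus the gaps between them
    on the first edge, minus these gaps on the other edges. *)
Definition gap_coef al be : R :=
  if tag be != tag al then 0 else if is_anchor be then 1
  else if tag be == edge_first P then (pos be <= pos al)%:R
  else - (pos al <= pos be)%:R.

Definition from_gaps c : 'rV[R]_n := vector_of (fun al => \sum_be gap_coef al be * c be).

Lemma gap_coef_anchor al be : is_anchor al -> gap_coef al be = (be == al)%:R.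
Proof.
move=> aal; rewrite /gap_coef; have [e|ne] /= := eqVneq (tag be) (tag al); last first.
  by rewrite (_ : (be == al) = false) //; apply: contraNF ne => /eqP ->.
have [->|ne] := eqVneq be al; first by rewrite aal.
have npos : pos be <> pos al by move=> h; move/eqP: ne; apply; apply: root_eq.
move: (position_lt be) aal; rewrite /is_anchor e; case: ifP => _ lt /eqP al0.
  by rewrite (_ : (_ == _) = false) 1?(_ : (_ <= _)%N = false) //; lia.
by rewrite (_ : (_ == _) = false) 1?(_ : (_ <= _)%N = false) ?oppr0 //; lia.
Qed.

Lemma gap_coef_neighbour al be : ~~ is_anchor al ->
  gap_coef al be - gap_coef (neighbour al) be =
  if tag al == edge_first P then (be == al)%:R else - (be == al)%:R.
Proof.
move=> nal; have [tE pE] := neighbourP nal.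
rewrite /gap_coef tE; have [e|ne] /= := eqVneq (tag be) (tag al); last first.
  rewrite (_ : (be == al) = false) ?subrr ?oppr0 ?if_same //.
  by apply: contraNF ne => /eqP ->.
have -> : (be == al) = (pos be == pos al).
  by apply/eqP/eqP => [->//|h]; apply: root_eq.
case: ifP => abe.
  rewrite subrr (_ : (pos be == pos al) = false) ?oppr0 ?if_same //.
  apply: contraNF nal => /eqP h; move: abe; rewrite /is_anchor e h //.
rewrite pE e; move: nal; rewrite /is_anchor; case: ifP => _ nal.
  have [-> | h] := eqVneq (pos be) (pos al).
    by rewrite leqnn (_ : (_ <= _)%N = false) ?subr0 //; lia.
  by rewrite (_ : (_ <= (pos al).-1)%N = (pos be <= pos al)%N) ?subrr //; lia.
have [-> | h] := eqVneq (pos be) (pos al).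
  by rewrite leqnn ltnn opprK addr0.
by rewrite (_ : (pos al < pos be)%N = (pos al <= pos be)%N) ?subrr ?oppr0 //; lia.
Qed.

Lemma gap_from_gaps c al : gap (from_gaps c) al = c al.
Proof.
have delta (k : R) : \sum_be k * (be == al)%:R * c be = k * c al.
  rewrite (bigD1 al) //= eqxx mulr1 big1 ?addr0 // => be /negPf ->.
  by rewrite mulr0 mul0r.
rewrite /gap !vector_ofE; case: ifP => aal.
  by under eq_bigr do rewrite gap_coef_anchor // -[_%:R]mul1r; rewrite delta mul1r.
rewrite -!sumrB; case: ifP => t0.
  under eq_bigr do rewrite -mulrBl gap_coef_neighbour ?aal // t0 -[_%:R]mul1r.
  by rewrite delta mul1r.
under eq_bigr do rewrite -mulrBl -opprB gap_coef_neighbour ?aal // t0 opprK -[_%:R]mul1r.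
by rewrite delta mul1r.
Qed.

Lemma gap_inj a b : (forall al, gap a al = gap b al) -> a = b.
Proof.
move=> ab; apply: coordinateP => al.
pose h al := if tag al == edge_first P then pos al else ((edge_length (tag al)).-1 - pos al)%N.
move: {2}(h al) (erefl (h al)) => k; elim/ltn_ind: k al => k IH al hk.
have := ab al; rewrite /gap; case: ifP => // aal.
have [tE pE] := neighbourP (negbT aal).
have -> : a.[: neighbour al] = b.[: neighbour al].
  apply: (IH (h (neighbour al))) => //; rewrite -hk /h tE pE.
  have := position_lt al; move: aal; rewrite /is_anchor; case: ifP => _; lia.
by case: ifP => _ /eqP; [rewrite subr_eq subrK => /eqP|rewrite -subr_eq0 opprB addrC subrKA subr_eq0 => /eqP ->].
Qed.

Lemma from_gapsK b : from_gaps (gap b) = b.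
Proof. by apply: gap_inj => al; rewrite gap_from_gaps. Qed.

Lemma gap_ge0 a al : harnack_roots a -> ~~ is_anchor al -> 0 <= gap a al.
Proof.
move=> /harnack_rootsP[_ ma] nal; have [tE pE] := neighbourP nal.
have le be ga : tag be = tag ga -> (pos be <= pos ga)%N -> a.[: be] <= a.[: ga].
  by case: be => i j; case: ga => k l /= e; move: l; rewrite -e => l; apply: ma.
rewrite /gap (negPf nal); case: ifP pE => _ pE; rewrite subr_ge0; apply: le => //; lia.
Qed.

Lemma from_gaps_harnack c : (forall al, ~~ is_anchor al -> 0 <= c al) ->
  tag_increasing (coordinate (from_gaps c)) -> harnack_roots (from_gaps c).
Proof.
move=> c0 inc; apply/harnack_rootsP; split=> // i j l jl.
rewrite !vector_ofE; apply: ler_sum => be _; rewrite /gap_coef /=.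
case: ifP => // _; case: ifP => // abe; case: ifP => _; apply: ler_wpM2r;
  rewrite ?c0 ?abe //.
  by rewrite ler_nat; case: (leqP (pos be) _) => //= h; rewrite (leq_trans h).
rewrite lerN2 ler_nat /position /=.
case: (leqP l (tagged be)) => //= h.
  by rewrite (leq_trans jl).
Qed.

(** The coordinates constrained to be nonnegative come first, as [corner_sector] requires; the three
    anchors fixed by the normal form are left out. *)
Definition free_roots : seq I :=
  [seq al <- enum I | ~~ is_anchor al] ++
  [seq al <- enum I | is_anchor al & al \notin [:: anchor0 P; anchor1 P; anchor2 P]].

Lemma anchors : [/\ is_anchor (anchor0 P), is_anchor (anchor1 P) & is_anchor (anchor2 P)].
Proof.
have m3 := nb_edges_ge3 P.
split; rewrite /is_anchor /= /pos ?eqxx //.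
by rewrite (_ : (_ == _) = false) ?eqxx //; apply/eqP => /(congr1 val) /=; lia.
Qed.

Lemma mem_free_roots al : (al \in free_roots) = (al \notin [:: anchor0 P; anchor1 P; anchor2 P]).
Proof.
have E (p : pred I) : (al \in [seq x <- enum I | p x]) = p al.
  by rewrite mem_filter mem_enum andbT.
rewrite mem_cat !E /=.
have [aal|nal] := boolP (is_anchor al) => //=.
apply/esym; apply: contraNT nal; rewrite negbK !inE.
by have [h0 h1 h2] := anchors => /or3P[] /eqP ->.
Qed.

Lemma free_roots_uniq : uniq free_roots.
Proof.
rewrite cat_uniq; apply/and3P; split; [exact/filter_uniq/enum_uniq| |exact/filter_uniq/enum_uniq].
apply/hasPn => al.
by rewrite mem_filter => /andP[/andP[aal _] _]; rewrite mem_filter aal.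
Qed.

Lemma anchors_uniq : uniq [:: anchor0 P; anchor1 P; anchor2 P].
Proof.
have m3 := nb_edges_ge3 P.
have ne al be : (tag al < tag be)%N -> al == be = false.
  by move=> h; apply/eqP => e; move: h; rewrite e ltnn.
rewrite /= !inE !negb_or !ne //=; lia.
Qed.

Lemma size_free_roots : size free_roots = (n - 3)%N.
Proof.
rewrite -(card_uniqP free_roots_uniq) /nb_boundary_points.
rewrite -(cardC (mem free_roots)) (_ : #|[predC mem free_roots]| = 3) ?addnK //.
transitivity #|[:: anchor0 P; anchor1 P; anchor2 P]|.
  by apply: eq_card => al; rewrite [LHS]inE /= mem_free_roots negbK.
exact/card_uniqP/anchors_uniq.
Qed.

End GapCoordinates.

Local Open Scope quotient_scope.

(** * The chart of the moduli space *)

Section ModuliChart.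
Variables (R : realType) (P : lattice_polygon).
Notation n := (nb_boundary_points P).
Notation I := (root_index P).
Notation m := (nb_edges P).
Implicit Types (a b w : 'rV[R]_n) (al be : I) (y : 'rV[R]_(n - 3)).
Local Notation "w .[: al ]" := (coordinate w al) (at level 2, format "w .[: al ]").
Local Notation proj := (@rational_harnack_proj R P).

Lemma proj_eq (a b : set_type (@harnack_roots R P)) :
  proj a = proj b <-> moebius_related (val a) (val b).
Proof. by split=> [/eqmodP/asboolP//|h]; apply/eqmodP/asboolP. Qed.

Lemma proj_repr (x : rational_harnack R P) : proj (repr x) = x.
Proof. exact: reprK. Qed.

Definition anchor_value al : R :=
  if al == anchor0 P then 0 else if al == anchor1 P then 2^-1 else 1.

(** The index is out of range exactly for the three normalizing anchors, which receive their
    prescribed values. *)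
Definition free_coordinate y al : R :=
  if insub (index al (free_roots P)) is Some i then y ord0 i else anchor_value al.

Definition from_chart y : 'rV[R]_n := from_gaps (free_coordinate y).

Definition gap_row b : 'rV[R]_(n - 3) :=
  \row_i gap b (nth (anchor0 P) (free_roots P) i).

Definition chart a : 'rV[R]_(n - 3) := gap_row (normal_form a).

Definition normalized b :=
  [/\ b.[: anchor0 P] = 0, b.[: anchor1 P] = 2^-1 & b.[: anchor2 P] = 1].

Lemma normal_form_normalized a : harnack_roots a -> normalized (normal_form a).
Proof.
by move=> Ha; split; rewrite ?normal_form_anchor0 ?normal_form_anchor1 ?normal_form_anchor2.
Qed.

Lemma normalized_form b : normalized b -> normal_form b = b.
Proof.
move=> [b0 b1 b2]; apply: coordinateP => al.
rewrite vector_ofE /normal_den /normal_num b0 b1 b2 !subr0.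
have -> : b.[: al] * (1 - 2^-1) + 2^-1 * (1 - b.[: al]) = 2^-1 by field.
by field.
Qed.

Lemma free_coordinateE b al : normalized b -> free_coordinate (gap_row b) al = gap b al.
Proof.
move=> [b0 b1 b2]; have [a0 a1 a2] := anchors P.
rewrite /free_coordinate; case: insubP => [i lt ie|].
  by rewrite mxE ie nth_index // -index_mem size_free_roots.
rewrite -(size_free_roots P) index_mem mem_free_roots negbK !inE /anchor_value.
case: eqP => [-> _|_]; first by rewrite /gap a0 b0.
case: eqP => [-> _|_]; first by rewrite /gap a1 b1.
by move=> /eqP ->; rewrite /gap a2 b2.
Qed.

Lemma gap_rowK b : normalized b -> from_chart (gap_row b) = b.
Proof.
move=> nb; rewrite -[RHS]from_gapsK; congr from_gaps.
by apply/funext => al; apply: free_coordinateE.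
Qed.

Lemma from_chartK y : gap_row (from_chart y) = y.
Proof.
apply/rowP => i; rewrite mxE gap_from_gaps /free_coordinate.
rewrite index_uniq ?free_roots_uniq ?size_free_roots ?ltn_ord //.
by rewrite valK.
Qed.

Lemma from_chart_normalized y : normalized (from_chart y).
Proof.
have [a0 a1 a2] := anchors P.
have E al : is_anchor al -> al \in [:: anchor0 P; anchor1 P; anchor2 P] ->
    (from_chart y).[: al] = anchor_value al.
  move=> aal mal; transitivity (gap (from_chart y) al); first by rewrite /gap aal.
  rewrite gap_from_gaps /free_coordinate insubF //.
  by rewrite -(size_free_roots P) index_mem mem_free_roots mal.
have /= := anchors_uniq P; rewrite !inE negb_or => /andP[/andP[n01 n02] /andP[n12 _]].
split; rewrite E ?inE ?eqxx ?orbT // /anchor_value ?eqxx //.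
by rewrite eq_sym (negPf n02) eq_sym (negPf n12).
Qed.

Lemma elementary_from_chart (U : set 'rV[R]_(n - 3)) al :
  elementary U (fun y => (from_chart y).[: al]).
Proof.
rewrite (_ : (fun _ => _) = fun y => \sum_be gap_coef R al be * free_coordinate y be).
  apply: elementary_sum => be; apply: elementaryM; first exact: elementary_cst.
  rewrite /free_coordinate; case: insub => [i|]; first exact: elementary_coord.
  exact: elementary_cst.
by apply/funext => y; rewrite vector_ofE.
Qed.

Lemma open_elementary_gt0 k (f : 'rV[R]_k -> R) : elementary setT f -> open [set x | 0 < f x].
Proof.
move=> ef; have [df _] := elementary_differentiable ef.
have cf : continuous f by move=> x; apply: differentiable_continuous; apply: df.
have -> : [set x | 0 < f x] = f @^-1` [set t : R | 0 < t] by [].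
by apply: open_comp; [move=> x _; exact: cf|exact: open_gt].
Qed.

Lemma open_forall (T : topologicalType) (J : finType) (A : J -> set T) :
  (forall j, open (A j)) -> open [set x | forall j, A j x].
Proof.
move=> oA; rewrite openE => x Ax.
apply: (@filterS _ (nbhs x) _ [set x | forall j, A j x]) => //.
by apply: filter_forall => j; apply: open_nbhs_nbhs; split; [exact: oA|exact: Ax].
Qed.

(** Only roots of different edges are compared: these strict inequalities are the open part of
    [harnack_roots], the order within an edge being the sector condition. *)
Definition chart_domain : set 'rV[R]_(n - 3) :=
  [set y | tag_increasing (coordinate (from_chart y))].

Lemma open_tag_increasing k (f : I -> 'rV[R]_k -> R) :
  (forall al, elementary setT (f al)) ->
  open [set y | tag_increasing (fun al => f al y)].
Proof.
move=> ef.
rewrite (_ : [set _ | _] = [set y | forall p : I * I, ((tag p.1 < tag p.2)%N ->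
    0 < f p.2 y - f p.1 y)]); last first.
  apply/seteqP; split=> y /= h.
    by move=> p /h; rewrite subr_gt0.
  by move=> al be ab; have := h (al, be) ab; rewrite subr_gt0.
apply: (@open_forall _ _ (fun p => [set y | _])) => -[al be] /=.
have [lt|_] := boolP (tag al < tag be)%N; last first.
  by rewrite (_ : [set _ | _] = setT); [exact: openT|apply/seteqP; split].
rewrite (_ : [set _ | _] = [set y | 0 < f be y - f al y]).
  by apply: open_elementary_gt0; apply: elementaryB.
by apply/seteqP; split=> y /= h; [exact: h|move=> _; exact: h].
Qed.

Lemma open_chart_domain : open chart_domain.
Proof.
apply: (@open_tag_increasing _ (fun al y => (from_chart y).[: al])) => al.
exact: elementary_from_chart.
Qed.

Lemma chart_harnack y : chart_domain y ->
  corner_sector (size [seq al <- enum I | ~~ is_anchor al]) y ->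
  harnack_roots (from_chart y).
Proof.
move=> Dy sy; apply: from_gaps_harnack => // al nal.
rewrite /free_coordinate; case: insubP => [i lt ie|].
  apply: sy; rewrite ie index_cat mem_filter nal mem_enum /=.
  by rewrite index_mem mem_filter nal mem_enum.
rewrite -(size_free_roots P) index_mem mem_free_roots negbK !inE.
by have [h0 h1 h2] := anchors P; case/or3P => /eqP e; move: nal; rewrite e ?h0 ?h1 ?h2.
Qed.

Lemma chart_sector a : harnack_roots a ->
  corner_sector (size [seq al <- enum I | ~~ is_anchor al]) (chart a).
Proof.
move=> Ha i ip; rewrite mxE; apply: gap_ge0; first exact: normal_form_harnack.
have := mem_nth (anchor0 P) ip; rewrite mem_filter => /andP[h _].
by rewrite nth_cat ip.
Qed.

Lemma chartK a : harnack_roots a -> from_chart (chart a) = normal_form a.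
Proof. by move=> Ha; apply/gap_rowK/normal_form_normalized. Qed.

Lemma chart_in_domain a : harnack_roots a -> chart_domain (chart a).
Proof.
by move=> Ha; rewrite /chart_domain /= chartK //; apply/harnack_increasing/normal_form_harnack.
Qed.

Lemma from_chart_chart y : chart (from_chart y) = y.
Proof. by rewrite /chart normalized_form ?from_chartK //; apply: from_chart_normalized. Qed.

Definition moduli_chart (x : rational_harnack R P) := chart (val (repr x)).

Lemma moduli_chart_proj (a : set_type (@harnack_roots R P)) : moduli_chart (proj a) = chart (val a).
Proof.
rewrite /moduli_chart /chart (@normal_form_eq _ _ _ (val a)) //.
by apply/proj_eq; rewrite proj_repr.
Qed.

Lemma harnack_val (a : set_type (@harnack_roots R P)) : harnack_roots (val a).
Proof. exact: set_mem (valP a). Qed.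

Definition to_roots a (Ha : harnack_roots a) : set_type (@harnack_roots R P) :=
  SigSub (mem_set Ha).

(** One chart covers the moduli space. Its section sends a class to its normal form, whose roots are
    affine functions of the chart coordinates. *)
Lemma moduli_smooth_chart : smooth_chart
    (fun a : set_type (@harnack_roots R P) => set_val a) proj setT moduli_chart.
Proof.
split.
- exact: openT.
- exists (size [seq al <- enum I | ~~ is_anchor al]), chart_domain.
  split; first exact: open_chart_domain.
  apply/seteqP; split=> [_ [x _ <-]|y [Dy sy]].
    by split; [apply: chart_in_domain|apply: chart_sector]; apply: harnack_val.
  exists (proj (to_roots (chart_harnack Dy sy))) => //.
  by rewrite moduli_chart_proj /= from_chart_chart.
(* The normal form is rational in the roots; positivity of its denominators is an open condition
   that holds on all of [harnack_roots]. *)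
- move=> a _; pose U : set 'rV[R]_n := [set b | forall al, 0 < normal_den b al].
  have ec (V : set 'rV[R]_n) al : elementary V (fun b => b.[: al]) by apply: elementary_coord.
  have en (V : set 'rV[R]_n) al : elementary V (fun b => normal_num b al).
    by apply: elementaryM; apply: elementaryB.
  have ed (V : set 'rV[R]_n) al : elementary V (fun b => normal_den b al).
    by apply: elementaryD => //; apply: elementaryM; apply: elementaryB.
  have oU : open U by apply: open_forall => al; apply: open_elementary_gt0.
  have ef al : elementary U (fun b => (normal_form b).[: al]).
    rewrite (_ : (fun _ => _) = fun b => normal_num b al * (normal_den b al)^-1).
      by apply: elementaryM => //; apply: elementaryV => // b /(_ al) /lt0r_neq0.
    by apply/funext => b; rewrite vector_ofE.
  exists U, chart; split.
  + apply: smooth_on_elementary => // j.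
    rewrite (_ : (fun _ => _) = fun b => gap (normal_form b) (nth (anchor0 P) (free_roots P) j)).
      rewrite /gap; case: is_anchor => //; case: eqP => _; exact: elementaryB.
    by apply/funext => b; rewrite mxE.
  + by move=> al; apply: normal_den_gt0; apply: harnack_val.
  + by move=> b _ _; rewrite moduli_chart_proj.
- exists (fun x => to_roots (normal_form_harnack (harnack_val (repr x)))); split.
    move=> x _; rewrite -[RHS]proj_repr; apply/proj_eq.
    by apply: moebius_related_sym; apply: normal_form_related; apply: harnack_val.
  move=> x _; exists setT, from_chart; split=> //.
    apply: smooth_on_elementary; first exact: openT.
    move=> j; have := elementary_from_chart setT (enum_val j).
    by rewrite /coordinate enum_valK.
  by move=> z _ _; rewrite chartK //; apply: harnack_val.
Qed.

End ModuliChart.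

(** * The differential of [rho] *)

Section RhoDifferential.
Variables (R : realType) (P : lattice_polygon).
Notation I := (root_index P).
Implicit Types (a z : I -> R) (al be : I).
Local Notation u := (@root_normal R P).

Definition rho_diff a z al :=
  \sum_be wedge (u be) (u al) * ((z al - z be) / (a al - a be)).

Definition moment a : R * R := (\sum_al a al * (u al).1, \sum_al a al * (u al).2).

Lemma wedge_moment a w : wedge (moment a) w = \sum_al a al * wedge (u al) w.
Proof.
rewrite /wedge /moment /= !mulr_suml -sumrB; apply: eq_bigr => al _; ring.
Qed.

(** For the first and the last edge the cyclic order starting there is the linear order of the other
    edges, so Chebyshev's inequality applies to the increasing function [a] itself. *)
Lemma wedge_moment_gt0 a i : tag_increasing a -> i = edge_first P \/ i = edge_last P ->
  0 < wedge (moment a) (normal R i).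
Proof.
move=> sa hi; rewrite wedge_moment.
under eq_bigr do rewrite mulrC.
apply: sum_mulr_gt0 => [||al be _ _ ha hb].
- exact: wedge_root_sum.
- have [be h] := wedge_root_neq0 R (first_root i).
  by exists be => //; rewrite mem_index_enum.
apply: sa.
have [[h1 h2]|[h1 h2]|[h1 h2]] := normal_pattern ha hb => //.
case: hi => hi; move: h1 h2; rewrite hi //= => h1 h2.
have lt : (tag al < nb_edges P)%N := ltn_ord _.
by move: h2; rewrite prednK ?nb_edges_gt0 // => /(leq_trans lt); rewrite ltnn.
Qed.

Lemma moment_neq0 a : tag_increasing a -> moment a != 0.
Proof.
move=> sa; apply/eqP => c0.
have := wedge_moment_gt0 sa (or_introl (erefl (edge_first P))).
by rewrite c0 /wedge /= !mul0r subrr ltxx.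
Qed.

Section Differential.
Variable a : I -> R.
Hypothesis sa : tag_increasing a.

Lemma root_sub_neq0 al be : wedge (u be) (u al) != 0 -> a al - a be != 0.
Proof.
apply: contraNneq => /eqP; rewrite subr_eq0 => /eqP e.
by rewrite /root_normal (increasing_tag_eq sa e) wedgevv.
Qed.

(* The matrix of [rho_diff a] is symmetric. *)
Lemma rho_diff_sum z z' : 2 * \sum_al z' al * rho_diff a z al =
  \sum_al \sum_be wedge (u be) (u al) * ((z al - z be) / (a al - a be)) * (z' al - z' be).
Proof.
have E : \sum_al z' al * rho_diff a z al =
   - \sum_al \sum_be wedge (u be) (u al) * ((z al - z be) / (a al - a be)) * z' be.
  rewrite exchange_big /= -sumrN; apply: eq_bigr => al _.
  rewrite /rho_diff mulr_sumr -sumrN; apply: eq_bigr => be _.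
  have -> : (z be - z al) / (a be - a al) = (z al - z be) / (a al - a be).
    by rewrite -[z be - _]opprB -[a be - _]opprB invrN mulrNN.
  by rewrite (wedgeC (u be)); ring.
rewrite mulr2n mulrDl mul1r {2}E -sumrB; apply: eq_bigr => al _.
rewrite /rho_diff mulr_sumr -sumrB; apply: eq_bigr => be _; ring.
Qed.

Lemma rho_diff_energy z : 2 * \sum_al z al * rho_diff a z al = root_energy a z.
Proof.
rewrite rho_diff_sum; apply: eq_bigr => al _; apply: eq_bigr => be _.
by rewrite (wedgeC (u al)) -[a al - a be]opprB invrN; ring.
Qed.

(** By symmetry of the matrix, the pairing of [z] with the effect of the dilation [a], which is zero
    because the normals have sum zero. *)
Lemma rho_diff_orth z : \sum_al a al * rho_diff a z al = 0.
Proof.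
have two : (2 : R) != 0 by rewrite pnatr_eq0.
apply: (mulfI two); rewrite mulr0 rho_diff_sum.
transitivity (\sum_al \sum_be (z al * wedge (u be) (u al) - z be * wedge (u be) (u al))).
  apply: eq_bigr => al _; apply: eq_bigr => be _.
  have [->|/root_sub_neq0 h] := eqVneq (wedge (u be) (u al)) 0; first by rewrite !mul0r !mulr0 subrr.
  by field.
under eq_bigr do rewrite sumrB -mulr_sumr wedge_root_sum mulr0 sub0r.
rewrite sumrN exchange_big /= big1 ?oppr0 // => be _.
under eq_bigr do rewrite (wedgeC (u _)).
by rewrite -mulr_sumr sumrN wedge_root_sum oppr0 mulr0.
Qed.

Lemma rho_diff_sqr al : rho_diff a (fun be => a be ^+ 2) al = wedge (moment a) (u al).
Proof.
transitivity (\sum_be a be * wedge (u be) (u al) + a al * \sum_be wedge (u be) (u al)); last first.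
  by rewrite wedge_moment wedge_root_sum mulr0 addr0.
rewrite mulr_sumr -big_split; apply: eq_bigr => be _ /=.
have [->|/root_sub_neq0 h] := eqVneq (wedge (u be) (u al)) 0; first by rewrite !mul0r !mulr0 addr0.
by field.
Qed.

Lemma rho_diffB z k z' al :
  rho_diff a (fun be => z be - k * z' be) al = rho_diff a z al - k * rho_diff a z' al.
Proof.
rewrite /rho_diff mulr_sumr -sumrB; apply: eq_bigr => be _; ring.
Qed.

(* The quadratic polynomials are the infinitesimal Moebius transformations. *)
Lemma rho_diff_kernel z r : (forall al, rho_diff a z al = wedge r (u al)) ->
  exists c0 c1 c2, forall al, z al = c0 + c1 * a al + c2 * a al ^+ 2.
Proof.
move=> zr; have c0 := moment_neq0 sa.
(* Pairing the hypothesis with [a] kills its left side by [rho_diff_orth] and leaves this wedge, up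
   to sign, on the right. *)
have rc : wedge (moment a) r = 0.
  transitivity (- \sum_al a al * rho_diff a z al); last by rewrite rho_diff_orth oppr0.
  by rewrite wedge_moment -sumrN; apply: eq_bigr => al _; rewrite zr wedgeC mulrN.
have [k rk] : exists k, forall w, wedge r w = k * wedge (moment a) w.
  move: c0; rewrite pair_neq0 => /orP[] nz.
    exists (r.1 / (moment a).1) => w; apply: (mulIf nz).
    have -> : r.1 / (moment a).1 * wedge (moment a) w * (moment a).1 = r.1 * wedge (moment a) w by field.
    have -> : wedge r w * (moment a).1 = r.1 * wedge (moment a) w - w.1 * wedge (moment a) r.
      by rewrite /wedge; ring.
    by rewrite rc mulr0 subr0.
  exists (r.2 / (moment a).2) => w; apply: (mulIf nz).
  have -> : r.2 / (moment a).2 * wedge (moment a) w * (moment a).2 = r.2 * wedge (moment a) w by field.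
  have -> : wedge r w * (moment a).2 = r.2 * wedge (moment a) w - w.2 * wedge (moment a) r.
    by rewrite /wedge; ring.
  by rewrite rc mulr0 subr0.
have z0 al : rho_diff a (fun be => z be - k * a be ^+ 2) al = 0.
  by rewrite (rho_diffB z k (fun be => a be ^+ 2)) zr rho_diff_sqr rk subrr.
have [_] := root_energy_ge0 (fun be => z be - k * a be ^+ 2) sa.
rewrite -rho_diff_energy big1 => [|al _]; last by rewrite z0 mulr0.
rewrite mulr0 => /(_ erefl)[d0 [d1 dE]]; exists d0, d1, k => al.
by rewrite -dE subrK.
Qed.

End Differential.
End RhoDifferential.

(** * Immersion *)

Section SumDerivative.
Variables (R : realType) (V : normedModType R).

Lemma differentiable_sum_seq (J : Type) (s : seq J) (F : J -> V -> R) x :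
  (forall j, differentiable (F j) x) -> differentiable (fun y => \sum_(j <- s) F j y) x.
Proof.
move=> dF; elim: s => [|j s IH].
  by rewrite (_ : (fun _ => _) = cst 0) //; apply/funext => y; rewrite big_nil.
rewrite (_ : (fun _ => _) = F j + fun y => \sum_(j <- s) F j y); first exact: differentiableD.
by apply/funext => y; rewrite big_cons.
Qed.

Lemma derive_sum_seq (J : Type) (s : seq J) (F : J -> V -> R) x v :
  (forall j, differentiable (F j) x) ->
  'D_v (fun y => \sum_(j <- s) F j y) x = \sum_(j <- s) 'D_v (F j) x.
Proof.
move=> dF; elim: s => [|j s IH].
  rewrite big_nil (_ : (fun _ => _) = cst 0) ?derive_cst //.
  by apply/funext => y; rewrite big_nil.
rewrite big_cons -IH.
rewrite (_ : (fun _ => _) = F j + fun y => \sum_(j <- s) F j y); last first.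
  by apply/funext => y; rewrite big_cons.
by rewrite deriveD //; apply: diff_derivable => //; apply: differentiable_sum_seq.
Qed.

End SumDerivative.

Section RhoSmooth.
Variables (R : realType) (P : lattice_polygon) (k : nat).
Notation I := (root_index P).
Local Notation u := (@root_normal R P).
Implicit Types (f : I -> 'rV[R]_k -> R) (al be : I).

(** Terms with parallel normals vanish identically, among them all those between roots of one edge;
    the remaining logarithms are taken of nonzero differences. So [rho] is smooth even across
    coinciding roots. *)
Lemma elementary_rho (U : set 'rV[R]_k) f al : (forall al, elementary U (f al)) ->
  (forall y, U y -> tag_increasing (fun al => f al y)) ->
  elementary U (fun y => \sum_be wedge (u be) (u al) * ln `|f al y - f be y|).
Proof.
move=> ef inc; apply: elementary_sum => be.
have [e|ne] := eqVneq (wedge (u be) (u al)) 0.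
  rewrite e (_ : (fun _ => _) = fun=> 0); first exact: elementary_cst.
  by apply/funext => y; rewrite mul0r.
apply: elementaryM; first exact: elementary_cst.
apply: elementary_ln; first exact: elementaryB.
by move=> y /inc h; apply: root_sub_neq0 h _ _ ne.
Qed.

Lemma differentiable_rho (V : normedModType R) (f : I -> V -> R) x al :
  (forall al, differentiable (f al) x) -> tag_increasing (fun al => f al x) ->
  differentiable (fun y => \sum_be wedge (u be) (u al) * ln `|f al y - f be y|) x.
Proof.
move=> df inc; apply: differentiable_sum_seq => be.
have [e|ne] := eqVneq (wedge (u be) (u al)) 0.
  rewrite (_ : (fun _ => _) = cst 0) //.
  by apply/funext => y; rewrite e mul0r.
apply: (differentiableZ _ (differentiable_ln_norm _ _)); first exact: differentiableB.
exact: root_sub_neq0 inc _ _ ne.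
Qed.

Lemma derive_rho (V : normedModType R) (f : I -> V -> R) x v al : (forall al, differentiable (f al) x) ->
  tag_increasing (fun al => f al x) ->
  'D_v (fun y => \sum_be wedge (u be) (u al) * ln `|f al y - f be y|) x =
  rho_diff (fun al => f al x) (fun al => 'D_v (f al) x) al.
Proof.
move=> df inc.
have dsub be : differentiable (fun y => f al y - f be y) x by exact: differentiableB.
have dln be : wedge (u be) (u al) != 0 -> differentiable (fun y => ln `|f al y - f be y|) x.
  by move=> ne; apply: differentiable_ln_norm => //; apply: root_sub_neq0 inc _ _ ne.
have term0 be : wedge (u be) (u al) = 0 ->
    (fun y => wedge (u be) (u al) * ln `|f al y - f be y|) = cst 0.
  by move=> e; apply/funext => y; rewrite e mul0r.
rewrite derive_sum_seq => [|be]; last first.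
  have [/term0 -> //|ne] := eqVneq (wedge (u be) (u al)) 0.
  exact: (differentiableZ _ (dln _ ne)).
apply: eq_bigr => be _.
have [e|ne] := eqVneq (wedge (u be) (u al)) 0.
  by rewrite term0 // derive_cst e mul0r.
have := deriveZ (wedge (u be) (u al)) (diff_derivable (v := v) (dln _ ne)).
rewrite [in LHS](_ : _ \*: _ = fun y => wedge (u be) (u al) * ln `|f al y - f be y|) // => ->.
congr (_ * _); rewrite derive_ln_norm //; last exact: root_sub_neq0 inc _ _ ne.
by rewrite mulrC; congr (_ / _); apply: deriveB; apply: diff_derivable.
Qed.

End RhoSmooth.

(** The matrix [cokermx B] has the right kernel but too many columns. A basis of its column space
    keeps the kernel and has full column rank, which provides the left inverse [S]. *)
Lemma quotient_matrix (F : fieldType) (k n : nat) (B : 'M[F]_(k, n)) : row_free B ->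
  exists (L : 'M[F]_(n, n - k)) (S : 'M[F]_(n - k, n)), S *m L = 1%:M /\
    forall w : 'rV_n, w *m L = 0 <-> (w <= B)%MS.
Proof.
move=> /eqP rB; have E : \rank (cokermx B) = (n - k)%N by rewrite mxrank_coker rB.
rewrite -E; exists (col_base (cokermx B)), (pinvmx (col_base (cokermx B))); split.
  by rewrite mulVpmx // col_base_full.
move=> w; rewrite submxE -[in X in _ <-> X](mulmx_base (cokermx B)) mulmxA.
split=> [->|/eqP h]; first by rewrite mul0mx.
by apply: (row_free_inj (row_base_free (cokermx B))); rewrite h mul0mx.
Qed.

(** * Linear charts of the space of tentacle positions *)

Section TentaclePositions.
Variables (R : realType) (P : lattice_polygon).
Notation n := (nb_boundary_points P).
Notation I := (root_index P).
Implicit Types (a b w : 'rV[R]_n) (al be : I).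
Local Notation "w .[: al ]" := (coordinate w al) (at level 2, format "w .[: al ]").
Local Notation u := (@root_normal R P).
Local Notation tproj := (@tentacle_positions_proj R P).

Lemma tproj_eq w w' : tproj w = tproj w' <-> exists r, w' = translate r w.
Proof. by split=> [/eqmodP/asboolP//|h]; apply/eqmodP/asboolP. Qed.

Lemma tproj_repr (y : tentacle_positions R P) : tproj (repr y) = y.
Proof. exact: reprK. Qed.

Definition shift_mx : 'M[R]_(2, n) :=
  \matrix_(i, x) wedge (if i == ord0 then (1, 0) else (0, 1)) (u (enum_val x)).

Lemma mul_shift_mx (r : 'rV[R]_2) al :
  (r *m shift_mx).[: al] = wedge (r ord0 ord0, r ord0 ord_max) (u al).
Proof.
rewrite /coordinate mxE big_ord_recr big_ord_recr big_ord0 /= !mxE enum_rankK add0r.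
rewrite (_ : widen_ord _ _ = ord0) /=; last exact: val_inj.
by rewrite /wedge /=; ring.
Qed.

Lemma sub_shift_mx w : (w <= shift_mx)%MS <-> exists r, forall al, w.[: al] = wedge r (u al).
Proof.
split=> [/submxP[r ->]|[r wr]].
  by eexists => al; rewrite mul_shift_mx.
apply/submxP; exists (\row_i if i == ord0 then r.1 else r.2).
apply: coordinateP => al; rewrite wr mul_shift_mx !mxE.
by rewrite /wedge.
Qed.

Lemma shift_mx_free : row_free shift_mx.
Proof.
apply/inj_row_free => r r0.
have h al : wedge (r ord0 ord0, r ord0 ord_max) (u al) = 0.
  by rewrite -mul_shift_mx r0 /coordinate mxE.
have : (r ord0 ord0, r ord0 ord_max) == 0 :> R * R.
  apply: contraT => nz; have := wedge_normal_succ R (edge_first P).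
  have h1 := h (first_root (edge_first P)); have h2 := h (first_root (ordS (edge_first P))).
  rewrite wedgeC in h1; move/eqP: h1; rewrite oppr_eq0 => /eqP h1.
  by rewrite (wedge_parallel nz h1 h2) ltxx.
rewrite xpair_eqE => /andP[/eqP e1 /eqP e2].
apply/rowP => i; rewrite !mxE.
have [->|ne] := eqVneq i ord0; first exact: e1.
rewrite (_ : i = ord_max) ?e2 //; apply: val_inj => /=.
by have := ltn_ord i; move: ne; rewrite -val_eqE /=; lia.
Qed.

Lemma translate_sub w w' : (w' - w <= shift_mx)%MS <-> exists r, w' = translate r w.
Proof.
split=> [/sub_shift_mx[r h]|[r ->]].
  exists r; apply: coordinateP => al; rewrite translateE -h.
  by rewrite /coordinate !mxE; ring.
apply/sub_shift_mx; exists r => al.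
by have := translateE r w al; rewrite /coordinate !mxE => ->; rewrite addrC addKr.
Qed.

Definition position_chart (L : 'M[R]_(n, n - 2)) (y : tentacle_positions R P) : 'rV[R]_(n - 2) :=
  repr y *m L.

Section PositionChart.
Variables (L : 'M[R]_(n, n - 2)) (S : 'M[R]_(n - 2, n)).
Hypothesis SL : S *m L = 1%:M.
Hypothesis kerL : forall w : 'rV_n, w *m L = 0 <-> (w <= shift_mx)%MS.

Lemma position_chart_proj w : position_chart L (tproj w) = w *m L.
Proof.
apply/eqP; rewrite -subr_eq0 -mulmxBl; apply/eqP/kerL/translate_sub.
by apply/tproj_eq; rewrite tproj_repr.
Qed.

Lemma tproj_section y : tproj (position_chart L y *m S) = y.
Proof.
rewrite -[RHS]tproj_repr; apply/esym/tproj_eq/translate_sub/kerL.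
by rewrite mulmxBl -mulmxA SL mulmx1 subrr.
Qed.

Lemma elementary_mulmx k l (M : 'M[R]_(k, l)) (m : nat) (U : set 'rV[R]_m) (f : 'rV[R]_m -> 'rV[R]_k) :
  (forall i, elementary U (fun x => f x ord0 i)) ->
  forall j, elementary U (fun x => (f x *m M) ord0 j).
Proof.
move=> ef j; rewrite (_ : (fun _ => _) = fun x => \sum_i f x ord0 i * M i j).
  by apply: elementary_sum => i; apply: elementaryM => //; apply: elementary_cst.
by apply/funext => x; rewrite mxE.
Qed.

Lemma position_smooth_chart :
  smooth_chart (fun w : 'rV[R]_n => w) tproj setT (position_chart L).
Proof.
split.
- exact: openT.
- exists 0%N, setT; split; first exact: openT.
  apply/seteqP; split=> [y _|y _]; first by split.
  exists (tproj (y *m S)) => //.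
  by rewrite position_chart_proj -mulmxA SL mulmx1.
- move=> w _; exists setT, (fun w => w *m L); split=> //.
    apply: smooth_on_elementary; first exact: openT.
    by apply: (@elementary_mulmx _ _ _ _ setT id) => i; apply: elementary_coord.
  by move=> w' _ _; rewrite position_chart_proj.
- exists (fun y => position_chart L y *m S); split; first by move=> y _; apply: tproj_section.
  move=> y _; exists setT, (fun x => x *m S); split=> //.
  apply: smooth_on_elementary; first exact: openT.
  by apply: (@elementary_mulmx _ _ _ _ setT id) => i; apply: elementary_coord.
Qed.

Lemma elementary_rho_chart al : elementary (chart_domain (R := R) (P := P))
  (fun y => (rho (from_chart y)).[: al]).
Proof.
rewrite (_ : (fun _ => _) = fun y => \sum_be wedge (u be) (u al) *
   ln `|(from_chart y).[: al] - (from_chart y).[: be]|); last first.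
  by apply/funext => y; rewrite rhoE.
apply: (elementary_rho (f := fun al y => (from_chart y).[: al])) => // al'.
exact: elementary_from_chart.
Qed.

Lemma rho_tilde_immersive x : immersive_at
    (fun a : set_type (@harnack_roots R P) => set_val a) (fun w : 'rV[R]_n => w)
    (@rational_harnack_proj R P) tproj (n - 3) (n - 2) (@rho_tilde R P) x.
Proof.
exists setT, (@moduli_chart R P), setT, (position_chart L).
split=> //; [exact: moduli_smooth_chart|exact: position_smooth_chart|].
pose g y := rho (from_chart y) *m L.
have eg j : elementary (chart_domain (R := R) (P := P)) (fun y => g y ord0 j).
  apply: elementary_mulmx => i; have := elementary_rho_chart (enum_val i).
  by rewrite /coordinate enum_valK.
have sg : smooth_on (chart_domain (R := R) (P := P)) g.
  by apply: smooth_on_elementary => //; apply: open_chart_domain.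
exists (chart_domain (R := R) (P := P)), g; split=> //.
- by apply: chart_in_domain; apply: harnack_val.
(* Both sides come from root tuples of one class, the representative and its normal form; their
   images under [rho] differ by a translation, which [L] kills. *)
- move=> y _ _ _; rewrite /g /moduli_chart chartK; last exact: harnack_val.
  rewrite position_chart_proj; apply/eqP; rewrite -subr_eq0 -mulmxBl; apply/eqP/kerL.
  apply/translate_sub.
  have H := harnack_val (repr y).
  have rel : moebius_related (val (repr y)) (val (to_roots (normal_form_harnack H))).
    exact: normal_form_related.
  exact: rho_moebius rel.
have D0 : chart_domain (moduli_chart x) by apply/chart_in_domain/harnack_val.
suff inj v : 'd g (moduli_chart x) v = 0 -> v = 0.
  by move=> v w h; apply/eqP; rewrite -subr_eq0; apply/eqP/inj; rewrite linearB /= h subrr.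
set y0 := moduli_chart x in D0 *.
pose b al y := (from_chart y).[: al] : R.
have db al : differentiable (b al) y0.
  by have [h _] := elementary_differentiable (@elementary_from_chart R P setT al); exact: (h y0 Logic.I).
have drho al : differentiable (fun y => (rho (from_chart y)).[: al]) y0.
  by have [h _] := elementary_differentiable (elementary_rho_chart al); exact: (h y0 D0).
move=> dg0.
pose W : 'rV[R]_n := vector_of (rho_diff (b^~ y0) (fun al => 'D_v (b al) y0)).
have WE al : 'D_v (fun y => (rho (from_chart y)).[: al]) y0 = W.[: al].
  rewrite vector_ofE -derive_rho //; congr ('D_v _ y0).
  by apply/funext => y; rewrite rhoE.
have WL : W *m L = 0.
  have dgd : differentiable g y0 by have [_ /(_ 1%N)[h _]] := sg; apply: h.
  move: dg0; rewrite -deriveE // derive_mx; last exact: diff_derivable.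
  move=> /rowP h; apply/rowP => j; have hj := h j; rewrite !mxE in hj; rewrite !mxE -[RHS]hj.
  rewrite (_ : (fun _ => _) = fun y => \sum_i rho (from_chart y) ord0 i * L i j); last first.
    by apply/funext => y; rewrite mxE.
  have dr i : differentiable (fun y => rho (from_chart y) ord0 i) y0.
    by have := drho (enum_val i); rewrite /coordinate enum_valK.
  rewrite derive_sum_seq => [|i]; last by apply: differentiableM.
  apply: eq_bigr => i _; rewrite deriveMr; last exact: diff_derivable.
  have := WE (enum_val i); rewrite /coordinate enum_valK => ->.
  by rewrite mulrC.
have /kerL/sub_shift_mx[r Wr] := WL.
have [c0 [c1 [c2 cE]]] : exists c0 c1 c2, forall al,
    'D_v (b al) y0 = c0 + c1 * b al y0 + c2 * b al y0 ^+ 2.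
  by apply: (rho_diff_kernel D0 (r := r)) => al; rewrite -Wr vector_ofE.
have [b0 b1 b2] := from_chart_normalized y0.
have dcst al c : (forall y : 'rV[R]_(n - 3), b al y = c) -> 'D_v (b al) y0 = 0.
  by move=> bc; rewrite (_ : b al = cst c) ?derive_cst //; apply/funext.
(* The chart keeps three anchors at 0, 1/2 and 1. The quadratic polynomial expressing the velocities
   of the roots vanishes at these three points, hence is zero. *)
have e0 : c0 = 0.
  have := cE (anchor0 P); rewrite /b b0 expr0n /= !mulr0 !addr0 => <-.
  by apply: (dcst _ 0) => y; have [] := from_chart_normalized y.
have e1 : c1 * 2^-1 + c2 * 2^-1 ^+ 2 = 0.
  have := cE (anchor1 P); rewrite e0 add0r /b b1 => <-.
  by apply: (dcst _ 2^-1) => y; have [] := from_chart_normalized y.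
have e2 : c1 + c2 = 0.
  have := cE (anchor2 P); rewrite e0 add0r /b b2 expr1n !mulr1 => <-.
  by apply: (dcst _ 1) => y; have [] := from_chart_normalized y.
have c2_0 : c2 = 0 by move: e1 e2; lra.
have c1_0 : c1 = 0 by move: e2; rewrite c2_0 addr0.
have Db al : 'D_v (b al) y0 = 0 by rewrite cE e0 c1_0 c2_0 !mul0r !addr0.
apply/rowP => i; rewrite mxE.
pose al := nth (anchor0 P) (free_roots P) i.
have yE : (fun y : 'rV[R]_(n - 3) => y ord0 i) = fun y => gap (from_chart y) al.
  by apply/funext => y; rewrite -[in LHS](from_chartK y) mxE.
have <- : 'D_v (fun y : 'rV[R]_(n - 3) => y ord0 i) y0 = v ord0 i.
  have := derive_mx (@derivable_id _ _ y0 v : derivable (id : _ -> 'rV[R]_(n - 3)) y0 v).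
  by rewrite derive_id => /rowP/(_ i); rewrite mxE.
rewrite yE /gap; case: is_anchor; first exact: Db.
by case: eqP => _; [have := deriveB (diff_derivable (v := v) (db al)) (diff_derivable (v := v) (db (neighbour al)))
  |have := deriveB (diff_derivable (v := v) (db (neighbour al))) (diff_derivable (v := v) (db al))];
  rewrite !Db subrr.
Qed.

End PositionChart.

End TentaclePositions.

(** * Monotonicity *)

Section Monotone.
Variables (R : realType) (P : lattice_polygon).
Notation n := (nb_boundary_points P).
Notation I := (root_index P).
Implicit Types (a b w : 'rV[R]_n) (al be : I).
Local Notation "w .[: al ]" := (coordinate w al) (at level 2, format "w .[: al ]").
Local Notation u := (@root_normal R P).

Definition pairing v w : R := \sum_al v.[: al] * w.[: al].

Lemma pairing_translate v w r : moment (coordinate v) = 0 ->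
  pairing v (translate r w) = pairing v w.
Proof.
move=> mv; rewrite /pairing; under eq_bigr do rewrite translateE mulrDr.
rewrite big_split /= -[RHS]addr0; congr (_ + _).
transitivity (- wedge (moment (coordinate v)) r).
  by rewrite wedge_moment -sumrN; apply: eq_bigr => al _; rewrite wedgeC mulrN.
by rewrite mv /wedge /= !mul0r subrr oppr0.
Qed.

Lemma tag_increasing_line a v t : tag_increasing (coordinate a) ->
  tag_increasing (coordinate (a + v)) -> 0 <= t <= 1 ->
  tag_increasing (coordinate (a + t *: v)).
Proof.
move=> ia ib /andP[t0 t1] al be ab; have := ia _ _ ab; have := ib _ _ ab.
rewrite /coordinate !mxE; set x := a _ _; set y := a _ _; set p := v _ _; set q := v _ _ => l1 l2.
have h1 : 0 <= (1 - t) * (y - x) by rewrite mulr_ge0 ?subr_ge0 // ltW.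
move: t0; rewrite le_eqVlt => /orP[/eqP <-|t0]; first by rewrite !mul0r !addr0.
have h2 : 0 < t * ((y + q) - (x + p)) by rewrite mulr_gt0 ?subr_gt0.
by move: h1 h2; lra.
Qed.

Section Line.
Variables (a v : 'rV[R]_n).
Hypothesis inc : forall t : R, 0 <= t <= 1 -> tag_increasing (coordinate (a + t *: v)).
Hypothesis mv : moment (coordinate v) = 0.
Hypothesis v0 : v.[: anchor0 P] = 0.
Hypothesis vn0 : v != 0.

Let f al (t : R) := a.[: al] + t * v.[: al].
Let G t := pairing v (rho (a + t *: v)).

Let fE al t : (a + t *: v).[: al] = f al t.
Proof. by rewrite /coordinate !mxE. Qed.

Let df al (t : R) : is_derive t 1 (f al) (v.[: al]).
Proof.
have h : is_derive t 1 (fun t : R => v.[: al] * t) (v.[: al]).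
  by apply: is_derive_eq; rewrite /GRing.scale /= mulr1.
have -> : f al = cst a.[: al] + fun t : R => v.[: al] * t.
  by apply/funext => s; rewrite /f mulrC.
by apply: is_derive_eq; rewrite add0r.
Qed.

Let df' al (t : R) : differentiable (f al) t.
Proof. by apply/derivable1_diffP; have h := df al t; apply: ex_derive. Qed.

Let incf t : 0 <= t <= 1 -> tag_increasing (fun al => f al t).
Proof. by move=> t01 al be ab; have := inc t01 ab; rewrite !fE. Qed.

Let dG (t : R) : 0 <= t <= 1 ->
  is_derive t 1 G (root_energy (fun al => f al t) (coordinate v) / 2).
Proof.
move=> t01.
have GE : G = fun t => \sum_al v.[: al] *
    \sum_be wedge (u be) (u al) * ln `|f al t - f be t|.
  apply/funext => s; rewrite /G /pairing; apply: eq_bigr => al _; rewrite rhoE.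
  by under eq_bigr do rewrite !fE.
have dr al : differentiable (fun t => \sum_be wedge (u be) (u al) * ln `|f al t - f be t|) t.
  exact: differentiable_rho (incf t01).
have dvr al : differentiable (fun t => v.[: al] *
    \sum_be wedge (u be) (u al) * ln `|f al t - f be t|) t.
  exact: (differentiableZ _ (dr al)).
rewrite GE; apply: DeriveDef.
  by apply: diff_derivable; apply: differentiable_sum_seq.
rewrite derive_sum_seq //.
have -> : root_energy (fun al => f al t) (coordinate v) / 2 =
   \sum_al v.[: al] * rho_diff (fun al => f al t) (coordinate v) al.
  by rewrite -rho_diff_energy mulrC mulKf // pnatr_eq0.
apply: eq_bigr => al _.
have dd : derivable (fun t : R => \sum_be wedge (u be) (u al) * ln `|f al t - f be t|) t 1.
  exact: diff_derivable.
rewrite [LHS](deriveZ v.[: al] dd) derive_rho //; last exact: incf.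
congr (_ *: rho_diff _ _ _); apply/funext => be.
by have h := df be t; rewrite derive_val.
Qed.

(** The derivative of [G] is half the energy of [v]. Were it zero at an intermediate point, [v]
    would be affine in the roots there: its slope is zero because [v] has moment zero and the roots
    do not, its constant because [v] vanishes at the first anchor. *)
Lemma pairing_line_lt s t : 0 <= s -> s < t -> t <= 1 -> G s < G t.
Proof.
move=> s0 st t1.
have sub x : s <= x <= t -> 0 <= x <= 1.
  by move=> /andP[sx xt]; rewrite (le_trans s0 sx) (le_trans xt t1).
have [||c] := @MVT R G (fun x => root_energy (fun al => f al x) (coordinate v) / 2) s t st.
- by move=> x; rewrite in_itv /= => /andP[sx xt]; apply: dG; apply: sub; rewrite !ltW.
- apply: continuous_in_subspaceT => x; rewrite inE /= in_itv /= => xst.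
  apply: differentiable_continuous; apply/derivable1_diffP.
  by have h := dG (sub _ xst); apply: ex_derive.
rewrite in_itv /= => /andP[sc ct] e; rewrite -subr_gt0 e mulr_gt0 ?subr_gt0 //.
have c01 : 0 <= c <= 1 by apply: sub; rewrite !ltW.
have [e0 e1] := root_energy_ge0 (coordinate v) (incf c01).
rewrite divr_gt0 // lt_neqAle e0 andbT eq_sym; apply/eqP => /e1[d0 [d1 dE]].
have mc : moment (fun al => f al c) != 0 by apply: moment_neq0 (incf c01).
have d10 : d1 = 0.
  have E (x : R * R) : d1 * wedge (moment (fun al => f al c)) x = wedge (moment (coordinate v)) x.
    transitivity (d1 * \sum_al f al c * wedge (u al) x + d0 * \sum_al wedge (u al) x).
      by rewrite wedge_moment wedge_root_sum mulr0 addr0.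
    rewrite wedge_moment !mulr_sumr -big_split /=; apply: eq_bigr => al _.
    by rewrite dE; ring.
  apply: contraTeq mc => d1n; rewrite negbK; apply/eqP.
  have z (x : R * R) : wedge (moment (fun al => f al c)) x = 0.
    by apply: (mulfI d1n); rewrite E mv /wedge /= !mul0r subrr mulr0.
  have := z (0, 1); have := z (1, 0); rewrite /wedge !mulr0 !mulr1 !subr0 sub0r.
  by case: (moment _) => x y /= /eqP; rewrite oppr_eq0 => /eqP -> ->.
have d00 : d0 = 0 by have := dE (anchor0 P); rewrite v0 d10 mul0r addr0.
move/eqP: vn0; apply; apply: coordinateP => al.
by rewrite dE d00 d10 mul0r addr0 /coordinate mxE.
Qed.

End Line.

End Monotone.

(** * Representatives with a given moment *)

Section Slice.
Variables (R : realType) (P : lattice_polygon).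
Notation n := (nb_boundary_points P).
Notation I := (root_index P).
Implicit Types (a b w : 'rV[R]_n) (al be : I).
Local Notation "w .[: al ]" := (coordinate w al) (at level 2, format "w .[: al ]").
Local Notation u := (@root_normal R P).

(* The Moebius transformations fixing [0] and [1], by the position of their pole;
   multiplied by [1 - t] the sum below extends continuously to [t = 0] and [t = 1]. *)
Lemma pole_balance (b p : I -> R) :
  (forall al, 0 <= b al <= 1) -> \sum_al p al = 0 ->
  (forall al, b al = 0 -> 0 < p al) -> (forall al, b al = 1 -> 0 < p al) ->
  (exists al, b al = 0) -> (exists al, b al = 1) ->
  exists2 t, 0 < t < 1 & \sum_al p al * (b al / ((1 - 2 * t) * b al + t)) = 0.
Proof.
move=> b01 p0 pb0 pb1 [al0 e0] [al1 e1].
pose den al (t : R) := (1 - 2 * t) * b al + t.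
have den_gt0 al (t : R) : 0 <= t <= 1 -> 0 < b al -> b al < 1 -> 0 < den al t.
  move=> /andP[t0 t1] b0 b1; rewrite (_ : den al t = t * (1 - b al) + (1 - t) * b al); last first.
    by rewrite /den; ring.
  move: t0; rewrite le_eqVlt => /orP[/eqP <-|t0]; first by rewrite mul0r add0r subr0 mul1r.
  by rewrite ltr_pwDl ?mulr_gt0 ?mulr_ge0 ?subr_gt0 ?subr_ge0 // ltW.
(* For [b al = 1] the denominator is [1 - t], which the extra factor cancels, leaving the constant
   [p al]; for [0 < b al < 1] the denominator is positive on the whole closed interval. *)
pose h al (t : R) : R := if b al == 0 then 0 else if b al == 1 then p al
  else (1 - t) * p al * b al / den al t.
pose H t := \sum_al h al t.
have dh al (t : R) : 0 <= t <= 1 -> differentiable (h al) t.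
  move=> t01; rewrite /h; case: eqP => [_|b0]; first exact: differentiable_cst.
  case: eqP => [_|b1]; first exact: differentiable_cst.
  have /andP[b0' b1'] := b01 al.
  have d0 : den al t != 0.
    by rewrite lt0r_neq0 // den_gt0 // lt_neqAle; apply/andP; split=> //; apply/eqP => // /esym.
  have did (s : R) : differentiable (fun x : R => x) s by exact: ex_diff.
  have dcst (c : R) (s : R) : differentiable (fun _ : R => c) s by exact: differentiable_cst.
  apply: differentiableM.
    by apply: differentiableM => //; apply: differentiableM => //; apply: differentiableB.
  apply: differentiableV => //.
have cH : {within `[0, 1], continuous H}.
  apply: continuous_in_subspaceT => t; rewrite inE /= in_itv /= => t01.
  by apply: differentiable_continuous; apply: differentiable_sum_seq => al; apply: dh.
(* At [t = 0] each term with [b al != 0] is [p al]; as the total is zero, [H 0] is minus the sum of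
   the positive weights at [b al = 0]. *)
have H0 : H 0 < 0.
  have -> : H 0 = - \sum_(al | b al == 0) p al.
    apply/eqP; rewrite -addr_eq0 -[X in _ == X]p0 /H [X in X + _ == _](bigID (fun al => b al == 0)) /=.
    rewrite big1 ?add0r => [|al]; last by rewrite /h => ->.
    rewrite [X in _ == X](bigID (fun al => b al == 0)) /= addrC; apply/eqP; congr (_ + _).
    apply: eq_bigr => al nb; rewrite /h (negPf nb); case: eqP => // _.
    by rewrite /den subr0 mul1r mulr0 subr0 mul1r addr0 mulfK.
  rewrite oppr_lt0 (bigD1 al0) ?e0 //= ltr_pwDl ?pb0 //.
  by apply: sumr_ge0 => al /andP[/eqP/pb0/ltW].
have H1 : 0 < H 1.
  have -> : H 1 = \sum_(al | b al == 1) p al.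
    rewrite [RHS]big_mkcond; apply: eq_bigr => al _; rewrite /h.
    case: eqP => [->|_]; first by rewrite eq_sym oner_eq0.
    by case: eqP => // _; rewrite subrr !mul0r.
  rewrite (bigD1 al1) ?e1 //= ltr_pwDl ?pb1 //.
  by apply: sumr_ge0 => al /andP[/eqP/pb1/ltW].
have hv : Num.min (H 0) (H 1) <= 0 <= Num.max (H 0) (H 1).
  by rewrite ge_min le_max (ltW H0) (ltW H1) orbT.
have [t] := IVT ler01 cH hv.
rewrite in_itv /= => /andP[t0 t1] Ht.
have {}t0 : 0 < t by rewrite lt_neqAle t0 andbT; apply: contraTneq H0 => e; rewrite [X in H X]e Ht ltxx.
have {}t1 : t < 1 by rewrite lt_neqAle t1 andbT; apply: contraTneq H1 => e; rewrite -[X in H X]e Ht ltxx.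
exists t; first by rewrite t0.
have s0 : 1 - t != 0 by rewrite subr_eq0 gt_eqF.
apply: (mulfI s0); rewrite mulr0 -[RHS]Ht mulr_sumr; apply: eq_bigr => al _.
rewrite /h; case: eqP => [->|_]; first by rewrite mul0r !mulr0.
case: eqP => [->|_]; last by rewrite /den; ring.
by rewrite (_ : (1 - 2 * t) * 1 + t = 1 - t); [field|ring].
Qed.

Lemma moment_affine (k l : R) (z : I -> R) :
  moment (fun al => k * z al + l) = (k * (moment z).1, k * (moment z).2).
Proof.
have [s1 s2] := root_normal_sum R P.
rewrite /moment /=; congr pair; rewrite mulr_sumr.
  transitivity (\sum_al k * (z al * (u al).1) + l * \sum_al (u al).1).
    by rewrite mulr_sumr -big_split; apply: eq_bigr => al _ /=; ring.
  by rewrite s1 mulr0 addr0.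
transitivity (\sum_al k * (z al * (u al).2) + l * \sum_al (u al).2).
  by rewrite mulr_sumr -big_split; apply: eq_bigr => al _ /=; ring.
by rewrite s2 mulr0 addr0.
Qed.

(** Moving the pole makes the moment parallel to [c]; a dilation then adjusts its length, and a
    translation, which does not affect the moment, adjusts the first anchor. *)
Lemma slice_representative a b : harnack_roots a -> harnack_roots b ->
  exists b', [/\ harnack_roots b', moebius_related b b',
    moment (coordinate b') = moment (coordinate a)
    & b'.[: anchor0 P] = a.[: anchor0 P]].
Proof.
move=> Ha Hb; set c := moment (coordinate a).
have ia := harnack_increasing Ha.
have c_first : 0 < wedge c (normal R (edge_first P)).
  by apply: wedge_moment_gt0 => //; left.
have c_last : 0 < wedge c (normal R (edge_last P)).
  by apply: wedge_moment_gt0 => //; right.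
pose b1 := normal_form b.
have H1 : harnack_roots b1 := normal_form_harnack Hb.
have [v0 _ v2] := normal_form_normalized Hb.
have i1 := harnack_increasing H1.
(* The balance says that the new moment is parallel to [c]. The weights are positive at the values 0
   and 1 because these are taken only by roots of the first and of the last edge, respectively. *)
have [t t01 bal] : exists2 t, 0 < t < 1 &
    \sum_al wedge c (u al) * (b1.[: al] / ((1 - 2 * t) * b1.[: al] + t)) = 0.
  apply: pole_balance.
  - by move=> al; rewrite -v0 -v2 (anchor0_le H1) (anchor2_ge H1).
  - under eq_bigr do rewrite wedgeC; by rewrite sumrN wedge_root_sum oppr0.
  - move=> al h; have e := increasing_tag_eq i1 (etrans h (esym v0)).
    rewrite /root_normal e; exact: c_first.
  - move=> al h; have e := increasing_tag_eq i1 (etrans h (esym v2)).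
    rewrite /root_normal e; exact: c_last.
  - by exists (anchor0 P).
  - by exists (anchor2 P).
have /andP[t0 t1] := t01.
pose b2 := vector_of (fun al => b1.[: al] / ((1 - 2 * t) * b1.[: al] + t)).
have b2E al : b2.[: al] = b1.[: al] / ((1 - 2 * t) * b1.[: al] + t) := vector_ofE _ al.
have det : 0 < 1 * t - 0 * (1 - 2 * t) by rewrite mul1r mul0r subr0.
have mob al : 0 < (1 - 2 * t) * b1.[: al] + t /\
    b2.[: al] = (1 * b1.[: al] + 0) / ((1 - 2 * t) * b1.[: al] + t).
  split; last by rewrite b2E mul1r addr0.
  have := anchor0_le H1 al; have := anchor2_ge H1 al; rewrite v0 v2 => x1 x0.
  rewrite (_ : (1 - 2 * t) * b1.[: al] + t = t * (1 - b1.[: al]) + (1 - t) * b1.[: al]); last by ring.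
  move: x0; rewrite le_eqVlt => /orP[/eqP <-|x0]; first by rewrite subr0 mulr1 mulr0 addr0.
  by rewrite ltr_wpDl ?mulr_ge0 ?mulr_gt0 ?subr_gt0 ?subr_ge0 // ltW.
have H2 : harnack_roots b2 := moebius_harnack det mob H1.
have r12 : moebius_related b1 b2.
  by apply: (moebius_relatedI det) => al; have [/lt0r_neq0] := mob al.
have d_first : 0 < wedge (moment (coordinate b2)) (normal R (edge_first P)).
  by apply: wedge_moment_gt0; [apply: harnack_increasing|left].
set d := moment (coordinate b2) in d_first.
have dc : wedge d c = 0.
  transitivity (- \sum_al wedge c (u al) *
      (b1.[: al] / ((1 - 2 * t) * b1.[: al] + t))); last by rewrite bal oppr0.
  rewrite wedge_moment -sumrN; apply: eq_bigr => al _.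
  by rewrite b2E (wedgeC (u al)) mulNr opprK mulrC.
(* The ratio of the two parallel moments. It is positive because both have positive wedge with the
   first normal, so the affine map below preserves the order of the roots. *)
pose k := wedge c (normal R (edge_first P)) / wedge d (normal R (edge_first P)).
have k0 : 0 < k by rewrite divr_gt0.
have kd : c = (k * d.1, k * d.2).
  have nz := lt0r_neq0 d_first.
  rewrite [LHS]surjective_pairing; congr pair; apply: (mulIf nz).
    rewrite mulrAC /k divfK //.
    rewrite (_ : c.1 * _ = wedge c (normal R (edge_first P)) * d.1 + (normal R (edge_first P)).1 * wedge d c); last by rewrite /wedge; ring.
    by rewrite dc mulr0 addr0.
  rewrite mulrAC /k divfK //.
  rewrite (_ : c.2 * _ = wedge c (normal R (edge_first P)) * d.2 + (normal R (edge_first P)).2 * wedge d c); last by rewrite /wedge; ring.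
  by rewrite dc mulr0 addr0.
pose l := a.[: anchor0 P] - k * b2.[: anchor0 P].
pose b3 := vector_of (fun al => k * b2.[: al] + l).
have det3 : 0 < k * 1 - l * 0 by rewrite mulr1 mulr0 subr0.
have mob3 al : 0 < 0 * b2.[: al] + 1 /\
    b3.[: al] = (k * b2.[: al] + l) / (0 * b2.[: al] + 1).
  by rewrite mul0r add0r divr1 vector_ofE.
exists b3; split.
- exact: moebius_harnack det3 mob3 H2.
- apply: moebius_related_trans (normal_form_related Hb) _.
  apply: moebius_related_trans r12 _.
  by apply: (moebius_relatedI det3) => al; have [/lt0r_neq0] := mob3 al.
- have -> : coordinate b3 = fun al => k * b2.[: al] + l by apply/funext => al; rewrite vector_ofE.
  by rewrite moment_affine -kd.
- by rewrite vector_ofE /l addrC subrK.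
Qed.

End Slice.

(** * Embedding *)

Lemma continuous_norm_sub (R : realType) n (a : 'rV[R]_n) :
  continuous (fun x : 'rV[R]_n => `|x - a|).
Proof.
move=> x; apply: continuous_comp; last exact: norm_continuous.
apply: differentiable_continuous.
by apply: differentiableB => //; exact: ex_diff.
Qed.

Section Embedding.
Variables (R : realType) (P : lattice_polygon).
Notation n := (nb_boundary_points P).
Notation I := (root_index P).
Implicit Types (a b w v x : 'rV[R]_n) (al be : I).
Local Notation "w .[: al ]" := (coordinate w al) (at level 2, format "w .[: al ]").
Local Notation u := (@root_normal R P).
Local Notation proj := (@rational_harnack_proj R P).
Local Notation tproj := (@tentacle_positions_proj R P).

Lemma pairingB v w w' : pairing v (w - w') = pairing v w - pairing v w'.
Proof.
rewrite /pairing -sumrB; apply: eq_bigr => al _.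
by rewrite /coordinate !mxE mulrBr.
Qed.

Lemma pairingZ (t : R) v w : pairing (t *: v) w = t * pairing v w.
Proof.
rewrite /pairing mulr_sumr; apply: eq_bigr => al _.
by rewrite /coordinate !mxE mulrA.
Qed.

Lemma coordinate_le_norm v al : `|v.[: al]| <= `|v|.
Proof.
rewrite /coordinate [leRHS]/Num.Def.normr /= mx_normrE.
exact: (le_bigmax _ (fun ij => `|v ij.1 ij.2|) (ord0, enum_rank al)).
Qed.

(** The norm is the maximum norm, whence the factor [n]. *)
Lemma pairing_le v w : pairing v w <= n%:R * (`|v| * `|w|).
Proof.
rewrite (_ : n%:R * _ = \sum_(al : I) (`|v| * `|w|)); last first.
  by rewrite sumr_const mulr_natl.
apply: ler_sum => al _; apply: le_trans (ler_norm _) _.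
by rewrite normrM ler_pM // coordinate_le_norm.
Qed.

Lemma momentB a b : moment (coordinate a) = moment (coordinate b) ->
  moment (coordinate (a - b)) = 0.
Proof.
move=> [e1 e2]; rewrite /moment; congr pair; apply/eqP.
  rewrite (eq_bigr (fun al => a.[: al] * (u al).1 - b.[: al] * (u al).1)).
    by rewrite sumrB e1 subrr.
  by move=> al _; rewrite /coordinate !mxE mulrBl.
rewrite (eq_bigr (fun al => a.[: al] * (u al).2 - b.[: al] * (u al).2)).
  by rewrite sumrB e2 subrr.
by move=> al _; rewrite /coordinate !mxE mulrBl.
Qed.

Lemma open_increasing_roots : open [set x : 'rV[R]_n | tag_increasing (coordinate x)].
Proof.
apply: (@open_tag_increasing _ _ _ (fun al x => x.[: al])) => al.
exact: elementary_coord.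
Qed.

Lemma elementary_rho_coordinate al :
  elementary [set x : 'rV[R]_n | tag_increasing (coordinate x)] (fun x => (rho x).[: al]).
Proof.
rewrite (_ : (fun _ => _) = fun x => \sum_be wedge (u be) (u al) *
   ln `|x.[: al] - x.[: be]|); last by apply/funext => x; rewrite rhoE.
apply: (elementary_rho (f := fun al x => x.[: al])) => // al'.
exact: elementary_coord.
Qed.

Lemma closed_elementary k (f : 'rV[R]_k -> R) c : elementary setT f ->
  closed [set x | f x = c].
Proof.
move=> ef; have [df _] := elementary_differentiable ef.
have -> : [set x | f x = c] = f @^-1` [set t : R | t = c] by [].
apply: closed_comp => [x _|]; last exact: closed_eq.
by apply: differentiable_continuous; apply: df.
Qed.

(* Monotonicity of [rho] along the ray from [a] transports a lower bound on a
   small sphere around [a] to all remote roots. *)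
Lemma rho_separation a (e : R) : harnack_roots a -> 0 < e ->
  exists2 d : R, 0 < d & forall b r, harnack_roots b ->
    moment (coordinate b) = moment (coordinate a) ->
    b.[: anchor0 P] = a.[: anchor0 P] ->
    e <= `|b - a| -> d <= `|translate r (rho b) - rho a|.
Proof.
move=> Ha e0; have ia := harnack_increasing Ha.
pose U := [set x : 'rV[R]_n | tag_increasing (coordinate x)].
have [e1 /= e10 e1U] : exists2 e1 : R, 0 < e1 & forall x, `|x - a| < e1 -> U x.
  have : nbhs a U by apply: open_nbhs_nbhs; split=> //; exact: open_increasing_roots.
  move=> /nbhs_normP[e1 e10 h]; exists e1 => // x xa; apply: h.
  by rewrite /ball_ /= distrC.
(* A radius at most [e] and below [e1], so that the sphere lies in the open set [U] where [rho] is
   smooth. *)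
pose s := Num.min e (e1 / 2).
have s0 : 0 < s by rewrite lt_min e0 divr_gt0.
have se : s <= e by rewrite ge_min lexx.
have se1 : s < e1.
  by apply: (@le_lt_trans _ _ (e1 / 2)); [rewrite ge_min lexx orbT|rewrite ltr_pdivrMr // mulr_natr mulr2n ltrDl].
pose K := [set x : 'rV[R]_n | `|x - a| = s] `&`
  ([set x | \sum_al x.[: al] * (u al).1 = (moment (coordinate a)).1] `&`
   ([set x | \sum_al x.[: al] * (u al).2 = (moment (coordinate a)).2] `&`
    [set x | x.[: anchor0 P] = a.[: anchor0 P]])).
have KU x : K x -> U x by move=> [/= xs _]; apply: e1U; rewrite xs.
have Kmoment x : K x -> moment (coordinate x) = moment (coordinate a).
  move=> [_ [m1 [m2 _]]]; rewrite [RHS]surjective_pairing.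
  by congr pair; [exact: m1|exact: m2].
have cK : compact K.
  apply: bounded_closed_compact.
    exists (`|a| + s); split; first exact: num_real.
    move=> M MN x [/= xs _]; apply: ltW; apply: le_lt_trans MN.
    by rewrite -[x in `|x|](subrK a) (le_trans (ler_normD _ _)) // xs addrC.
  apply: closedI.
    rewrite (_ : [set _ | _] = (fun x => `|x - a|) @^-1` [set t : R | t = s]) //.
    by apply: closed_comp => [x _|]; [exact: continuous_norm_sub|exact: closed_eq].
  have em (f : I -> R) : elementary setT (fun x : 'rV[R]_n => \sum_al x.[: al] * f al).
    apply: elementary_sum => al; apply: elementaryM; [exact: elementary_coord|exact: elementary_cst].
  apply: closedI; first exact: closed_elementary.
  apply: closedI; first exact: closed_elementary.
  by apply: closed_elementary; apply: elementary_coord.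
pose F x := pairing (x - a) (rho x - rho a).
have eF : elementary U F.
  apply: elementary_sum => al.
  rewrite (_ : (fun _ => _) = fun x => (x.[: al] - a.[: al]) * ((rho x).[: al] - (rho a).[: al])).
    apply: elementaryM; apply: elementaryB; try exact: elementary_cst.
      exact: elementary_coord.
    exact: elementary_rho_coordinate.
  by apply/funext => x; rewrite /coordinate !mxE.
have [dF _] := elementary_differentiable eF.
have line x : U x -> forall t : R, 0 <= t <= 1 -> tag_increasing (coordinate (a + t *: (x - a))).
  by move=> Ux t t01; apply: tag_increasing_line => //; rewrite addrC subrK.
have Fpos x : K x -> 0 < F x.
  move=> Kx; have Ux := KU _ Kx; have [/= xs [_ [_ /= xa]]] := Kx.
  have xa0 : x - a != 0 by rewrite -normr_eq0 xs gt_eqF.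
  have x0 : (x - a).[: anchor0 P] = 0.
    by move: xa; rewrite /coordinate !mxE => ->; rewrite subrr.
  have := pairing_line_lt (line _ Ux) (momentB (Kmoment _ Kx)) x0 xa0 (lexx 0) ltr01 (lexx 1).
  by rewrite scale0r addr0 scale1r [a + _]addrC subrK /F pairingB subr_gt0.
have [m m0 mK] : exists2 m, 0 < m & forall x, K x -> m <= F x.
  have [[x0 Kx0]|K0] := pselect (K !=set0); last first.
    by exists 1 => // x Kx; exfalso; apply: K0; exists x.
  have cF : {within K, continuous F}.
    apply: continuous_in_subspaceT => x; rewrite inE => /KU Ux.
    by apply: differentiable_continuous; apply: dF.
  have [|c] := EVT_min_rV _ cK cF; first by exists x0.
  rewrite inE => Kc cmin; exists (F c); first exact: Fpos.
  by move=> x Kx; apply: cmin; rewrite inE.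
have N0 : 0 < n%:R + 1 :> R by rewrite ltr_wpDl.
(* The argument ends with [m <= s * n%:R * N'], where [N'] is the distance of the images; replacing
   [n%:R] by [n%:R + 1] makes positivity of the divisor immediate. *)
exists (m / (s * (n%:R + 1))); first by rewrite divr_gt0 // mulr_gt0.
move=> b r Hb mb b0 eb; set w := translate r (rho b).
have ib := harnack_increasing Hb.
set N := `|b - a| in eb *.
have NN0 : 0 < N by apply: lt_le_trans eb.
(* The parameter at which the segment from [a] to [b] crosses the sphere. *)
pose t := s / N.
have t0 : 0 < t by rewrite divr_gt0.
have t1 : t <= 1 by rewrite ler_pdivrMr // mul1r (le_trans se).
have mv := momentB mb.
have v0 : (b - a).[: anchor0 P] = 0.
  by move: b0; rewrite /coordinate !mxE => ->; rewrite subrr.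
have vn0 : b - a != 0 by rewrite -normr_eq0 gt_eqF.
pose x := a + t *: (b - a).
have xaE : x - a = t *: (b - a) by rewrite /x addrC addKr.
have Kx : K x.
  split; first by rewrite /= xaE normrZ gtr0_norm // -/N /t divfK // gt_eqF.
  have mx : moment (coordinate x) = moment (coordinate a).
    rewrite (_ : coordinate x = fun al => t * (b - a).[: al] + 1 * a.[: al]); last first.
      by apply/funext => al; rewrite /coordinate !mxE mul1r addrC.
    have [z1 z2] : ((moment (coordinate (b - a))).1 = 0) /\ ((moment (coordinate (b - a))).2 = 0).
      by rewrite mv.
    rewrite /moment; congr pair.
      transitivity (t * (moment (coordinate (b - a))).1 + (moment (coordinate a)).1).
        by rewrite mulr_sumr -big_split; apply: eq_bigr => al _ /=; ring.
      by rewrite z1 mulr0 add0r.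
    transitivity (t * (moment (coordinate (b - a))).2 + (moment (coordinate a)).2).
      by rewrite mulr_sumr -big_split; apply: eq_bigr => al _ /=; ring.
    by rewrite z2 mulr0 add0r.
  split; first exact: (congr1 fst mx).
  split; first exact: (congr1 snd mx).
  by rewrite /= /x; move: v0; rewrite /coordinate !mxE => ->; rewrite mulr0 addr0.
have incl := line _ ib.
have mono : pairing (b - a) (rho x) <= pairing (b - a) (rho b).
  have bE : b = a + 1 *: (b - a) by rewrite scale1r addrC subrK.
  move: t1; rewrite le_eqVlt => /orP[/eqP t1|t1].
    by rewrite /x t1 -bE.
  have := pairing_line_lt incl mv v0 vn0 (ltW t0) t1 (lexx 1).
  by rewrite -bE => /ltW.
have Fx : m <= t * (pairing (b - a) w - pairing (b - a) (rho a)).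
  apply: le_trans (mK _ Kx) _; rewrite /F xaE pairingZ pairingB ler_pM2l //.
  by rewrite lerD2r pairing_translate.
rewrite ler_pdivrMr ?mulr_gt0 //; apply: le_trans Fx _.
rewrite -pairingB; apply: (@le_trans _ _ (t * (n%:R * (N * `|w - rho a|)))).
  by rewrite ler_pM2l // pairing_le.
have -> : t * (n%:R * (N * `|w - rho a|)) = s * n%:R * `|w - rho a|.
  by rewrite /t; field; rewrite gt_eqF.
rewrite mulrC ler_wpM2l // ler_pM2l // lerDl //.
Qed.

Lemma slice_proj (z : rational_harnack R P) a : harnack_roots a ->
  exists b (Hb : harnack_roots b), [/\ proj (to_roots Hb) = z,
    moment (coordinate b) = moment (coordinate a)
    & b.[: anchor0 P] = a.[: anchor0 P]].
Proof.
move=> Ha; have [b [Hb rel mb b0]] := slice_representative Ha (harnack_val (repr z)).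
exists b, Hb; split=> //; rewrite -[RHS]proj_repr; apply/proj_eq.
exact: moebius_related_sym.
Qed.

(** Once both classes are represented in one slice, distinct representatives are separated at their
    own distance, contradicting equal images up to translation. *)
Lemma rho_tilde_inj : injective (@rho_tilde R P).
Proof.
move=> y z yz; pose a := val (repr y); have Ha : harnack_roots a := harnack_val (repr y).
have [b [Hb [bz mb b0]]] := slice_proj z Ha.
have : tproj (rho b) = tproj (rho a).
  by rewrite -[LHS](rho_tilde_pi (to_roots Hb)) bz -yz.
move=> /tproj_eq[r ar].
have [ba|ne] := eqVneq b a.
  rewrite -bz -[LHS]proj_repr; apply/proj_eq; rewrite /= ba.
  exact/asboolP/moebius_eq_refl.
have e0 : 0 < `|b - a| by rewrite normr_gt0 subr_eq0.
have [d d0 h] := rho_separation Ha e0.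
by have := h b r Hb mb b0 (lexx _); rewrite -ar subrr normr0 leNgt d0.
Qed.

(** Openness in the quotient of a subspace asks for an ambient open set; it exists because [rho] is
    continuous on the open set of tuples ordered between edges, beyond [harnack_roots]. *)
Lemma rho_tilde_continuous (O : set (tentacle_positions R P)) :
  open O -> open (@rho_tilde R P @^-1` O).
Proof.
move=> oO; rewrite /open /= /quotient_open.
pose B := [set x : 'rV[R]_n | tag_increasing (coordinate x) /\ O (tproj (rho x))].
exists B.
  rewrite openE => x [ix Ox].
  have nU : nbhs x [set x : 'rV[R]_n | tag_increasing (coordinate x)].
    by apply: open_nbhs_nbhs; split=> //; exact: open_increasing_roots.
  have cr : {for x, continuous (@rho R P)}.
    have : smooth_on [set x : 'rV[R]_n | tag_increasing (coordinate x)] (@rho R P).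
      apply: smooth_on_elementary; first exact: open_increasing_roots.
      move=> j; have := elementary_rho_coordinate (enum_val j).
      by rewrite /coordinate enum_valK.
    by move=> [_ /(_ 0%N) h]; apply: h.
  have nO : nbhs (rho x) (tproj @^-1` O) by apply: open_nbhs_nbhs; split.
  by apply: filterS (filterI nU (cr _ nO)) => y [].
apply/seteqP; split=> z /=.
  by move=> [_]; rewrite -[X in O X](rho_tilde_pi z).
move=> Oz; split; first exact/harnack_increasing/harnack_val.
by rewrite -[X in O X](rho_tilde_pi z).
Qed.

Lemma rho_tilde_open (U : set (rational_harnack R P)) : open U ->
  exists O : set (tentacle_positions R P), open O /\ U = @rho_tilde R P @^-1` O.
Proof.
move=> oU.
(* Balls around [rho a] that meet the positions of classes of [U] only. The set [O] is the union of
   their projections, so its preimage lies in [U]; [rho_separation] supplies such a ball for each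
   class of [U]. *)
pose near_image a (d : R) := forall z w, tproj w = rho_tilde z -> `|w - rho a| < d -> U z.
pose O := [set y | exists a d w, [/\ near_image a d, tproj w = y & `|w - rho a| < d]].
exists O; split.
  rewrite /open /= /quotient_open.
  (* The preimage of a projected ball is the union of its translates. *)
  rewrite (_ : _ @^-1` _ = \bigcup_(p in [set p : 'rV[R]_n * R * (R * R) | near_image p.1.1 p.1.2])
     [set w | `|translate p.2 w - rho p.1.1| < p.1.2]).
    apply: bigcup_open => -[[a d] r] _ /=.
    have ct : continuous (fun w : 'rV[R]_n => `|translate r w - rho a|).
      rewrite (_ : (fun _ => _) = fun w => `|w - (rho a - translate r 0)|).
        exact: continuous_norm_sub.
      apply/funext => w'; rewrite opprB addrA; congr (`|_ - _|); apply: coordinateP => al.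
      have := translateE r w' al; rewrite /coordinate !mxE => ->.
      by have := translateE r 0 al; rewrite /coordinate !mxE => ->; rewrite add0r.
    rewrite (_ : [set _ | _] = (fun w : 'rV[R]_n => `|translate r w - rho a|) @^-1` [set t | t < d]) //.
    by apply: open_comp => [w _|]; [exact: ct|exact: open_lt].
  apply/seteqP; split=> [w /= [a [d [w' [ni /esym/tproj_eq[r ->] lt]]]]|w [[[a d] r] /= ni lt]].
    by exists (a, d, r).
  exists a, d, (translate r w); split=> //; apply/esym/tproj_eq; by exists r.
apply/seteqP; split=> [x Ux|z /= [a [d [w [ni wz lt]]]]]; last exact: ni wz lt.
have Ha := harnack_val (repr x); set a := val (repr x) in Ha.
have [B oB BU] : open (proj @^-1` U) by exact: oU.
have Ba : B a.
  have : (set_val @^-1` B) (repr x) by rewrite BU /= proj_repr.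
  by [].
have [e e0 eB] : exists2 e : R, 0 < e & forall b, `|b - a| < e -> B b.
  have /nbhs_normP[e e0 h] : nbhs a B by apply: open_nbhs_nbhs.
  by exists e => // b ba; apply: h; rewrite /ball_ /= distrC.
have [d d0 sep] := rho_separation Ha e0.
exists a, d, (rho a); split.
- move=> z w wz lt; have [b [Hb [bz mb b0]]] := slice_proj z Ha.
  have [r wE] : exists r, w = translate r (rho b).
    by apply/tproj_eq; rewrite wz -bz (rho_tilde_pi (to_roots Hb)).
  have Bb : B b.
    apply: eB; rewrite ltNge; apply/negP => eb.
    by have := sep b r Hb mb b0 eb; rewrite -wE leNgt lt.
  have : (proj @^-1` U) (to_roots Hb) by rewrite -BU.
  by rewrite /= bz.
- by [].
- by rewrite subrr normr0.
Qed.

End Embedding.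

Theorem theorem3p3 (R : realType) (P : lattice_polygon) :
  smooth_embedding
    (fun a : set_type (@harnack_roots R P) => set_val a)
    (fun w : 'rV[R]_(nb_boundary_points P) => w)
    (@rational_harnack_proj R P) (@tentacle_positions_proj R P)
    (nb_boundary_points P - 3) (nb_boundary_points P - 2)
    (@rho_tilde R P).
Proof.
have [L [S [SL kerL]]] := quotient_matrix (shift_mx_free R P).
split; last by move=> x; apply: rho_tilde_immersive SL kerL x.
split; first exact: rho_tilde_inj.
move=> U; split; first exact: rho_tilde_open.
by move=> [V [oV ->]]; apply: rho_tilde_continuous.
Qed.
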